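(* For every analytic equivalence relation $E$ on a standard Borel space $Y$ there is a Borel map $f:Y\to\mathfrak M$ such that if $xEy$ then $f(x)$ and $f(y)$ are Lipschitz isomorphic, and if not $xEy$ then $f(x)$ and $f(y)$ are not homeomorphic. Consequently, the relation of uniform homeomorphism between complete separable metric spaces is a complete analytic equivalence relation (it is analytic and every analytic equivalence relation Borel reduces to it).
   Context: $\mathfrak M$ is the standard Borel space of complete separable metric spaces: the closed subsets of the Urysohn metric space $\mathbb U$ with the Effros–Borel structure (generated by the sets $\{F:F\cap U\neq\emptyset\}$, $U$ open). Metric spaces $X,Y$ are Lipschitz isomorphic if there are a bijection $f:X\to Y$ and $K\ge1$ with $K^{-1}d_X(x,y)\le d_Y(f(x),f(y))\le Kd_X(x,y)$; uniformly homeomorphic if there is a bijection $f$ with $f$ and $f^{-1}$ uniformly continuous. $E$ Borel reduces to $F$ if there is a Borel $g$ with $xEy\iff g(x)Fg(y)$. *)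

(* Defs.v *)
From Stdlib Require Import Reals List RelationClasses.
Open Scope R_scope.

Definition set (X : Type) := X -> Prop.

(* A family S of subsets of X is a sigma-algebra (we also ask closure under
   extensional equality of predicates, which is automatic for sets). *)
Definition is_sigma_algebra {X : Type} (S : set X -> Prop) : Prop :=
  S (fun _ => False) /\
  (forall A, S A -> S (fun x => ~ A x)) /\
  (forall A : nat -> set X, (forall n, S (A n)) -> S (fun x => exists n, A n x)) /\
  (forall A B, (forall x, A x <-> B x) -> S A -> S B).

Definition sigma_gen {X : Type} (G : set X -> Prop) : set X -> Prop :=
  fun A => forall S, is_sigma_algebra S -> (forall B, G B -> S B) -> S A.

Definition prod_sigma {X Z : Type} (SX : set X -> Prop) (SZ : set Z -> Prop)
  : set (X * Z) -> Prop :=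
  sigma_gen (fun C => exists A B, SX A /\ SZ B /\
                       forall p, C p <-> (A (fst p) /\ B (snd p))).

Definition measurable_map {X Z : Type} (SX : set X -> Prop) (SZ : set Z -> Prop)
  (f : X -> Z) : Prop :=
  forall B, SZ B -> SX (fun x => B (f x)).

Definition is_metric {X : Type} (d : X -> X -> R) : Prop :=
  (forall x y, 0 <= d x y) /\
  (forall x y, d x y = 0 <-> x = y) /\
  (forall x y, d x y = d y x) /\
  (forall x y z, d x z <= d x y + d y z).

Definition open_set {X : Type} (d : X -> X -> R) (V : set X) : Prop :=
  forall x, V x -> exists r, 0 < r /\ forall y, d x y < r -> V y.

Definition closed_set {X : Type} (d : X -> X -> R) (F : set X) : Prop :=
  open_set d (fun x => ~ F x).

Definition cauchy_seq {X : Type} (d : X -> X -> R) (u : nat -> X) : Prop :=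
  forall eps, 0 < eps -> exists N, forall m n, (N <= m)%nat -> (N <= n)%nat ->
    d (u m) (u n) < eps.

Definition converges_to {X : Type} (d : X -> X -> R) (u : nat -> X) (l : X) : Prop :=
  forall eps, 0 < eps -> exists N, forall n, (N <= n)%nat -> d (u n) l < eps.

Definition complete_metric {X : Type} (d : X -> X -> R) : Prop :=
  forall u, cauchy_seq d u -> exists l, converges_to d u l.

(* separable: a countable dense subset (possibly empty, hence [option]) *)
Definition separable_metric {X : Type} (d : X -> X -> R) : Prop :=
  exists s : nat -> option X, forall x eps, 0 < eps ->
    exists n y, s n = Some y /\ d x y < eps.

Definition polish_metric {X : Type} (d : X -> X -> R) : Prop :=
  is_metric d /\ complete_metric d /\ separable_metric d.

Definition borel {X : Type} (d : X -> X -> R) : set X -> Prop :=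
  sigma_gen (open_set d).

Definition standard_borel {X : Type} (SX : set X -> Prop) : Prop :=
  exists d : X -> X -> R, polish_metric d /\ forall A, SX A <-> borel d A.

Definition baire_sigma : set (nat -> nat) -> Prop :=
  sigma_gen (fun C => exists i n, forall z, C z <-> z i = n).

Definition analytic {X : Type} (SX : set X -> Prop) (A : set X) : Prop :=
  exists C : set (X * (nat -> nat)),
    prod_sigma SX baire_sigma C /\ forall x, A x <-> exists z, C (x, z).

Definition inverse_pair {A B : Type} (f : A -> B) (g : B -> A) : Prop :=
  (forall a, g (f a) = a) /\ (forall b, f (g b) = b).

Definition lipschitz_isomorphic {A B : Type} (dA : A -> A -> R) (dB : B -> B -> R)
  : Prop :=
  exists (f : A -> B) (g : B -> A) (K : R), inverse_pair f g /\ 1 <= K /\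
    forall x y, / K * dA x y <= dB (f x) (f y) /\ dB (f x) (f y) <= K * dA x y.

Definition continuous_map {A B : Type} (dA : A -> A -> R) (dB : B -> B -> R)
  (f : A -> B) : Prop :=
  forall x eps, 0 < eps -> exists del, 0 < del /\
    forall y, dA x y < del -> dB (f x) (f y) < eps.

Definition unif_continuous_map {A B : Type} (dA : A -> A -> R) (dB : B -> B -> R)
  (f : A -> B) : Prop :=
  forall eps, 0 < eps -> exists del, 0 < del /\
    forall x y, dA x y < del -> dB (f x) (f y) < eps.

Definition homeomorphic {A B : Type} (dA : A -> A -> R) (dB : B -> B -> R) : Prop :=
  exists (f : A -> B) (g : B -> A), inverse_pair f g /\
    continuous_map dA dB f /\ continuous_map dB dA g.

Definition unif_homeomorphic {A B : Type} (dA : A -> A -> R) (dB : B -> B -> R)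
  : Prop :=
  exists (f : A -> B) (g : B -> A), inverse_pair f g /\
    unif_continuous_map dA dB f /\ unif_continuous_map dB dA g.

(* (U, d) is an Urysohn space: a complete separable metric space with the
   finite extension property (every one-point metric extension of a finite
   subspace is realised in U).  Such a space exists and is unique up to
   isometry. *)
Definition urysohn {U : Type} (d : U -> U -> R) : Prop :=
  polish_metric d /\
  forall l : list (U * R),
    (forall p q, In p l -> In q l ->
        Rabs (snd p - snd q) <= d (fst p) (fst q) <= snd p + snd q) ->
    exists u, forall p, In p l -> d u (fst p) = snd p.

Definition Msp {U : Type} (d : U -> U -> R) : Type := { F : set U | closed_set d F }.

Definition effros {U : Type} (d : U -> U -> R) : set (Msp d) -> Prop :=
  sigma_gen (fun S => exists V, open_set d V /\
                forall F : Msp d, S F <-> exists x, proj1_sig F x /\ V x).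

Definition pts {U : Type} {d : U -> U -> R} (F : Msp d) : Type :=
  { x : U | proj1_sig F x }.

Definition mdist {U : Type} {d : U -> U -> R} (F : Msp d) : pts F -> pts F -> R :=
  fun a b => d (proj1_sig a) (proj1_sig b).

(* Main.v *)
Require Import Defs.
From Stdlib Require Import Reals List RelationClasses.
From Stdlib Require Import Arith Cantor ZArith Lia Lra.
From Stdlib Require Import Classical ClassicalEpsilon FunctionalExtensionality
  PropExtensionality ProofIrrelevance.
Import ListNotations.
Open Scope R_scope.

(* Code the points of [Y] by binary sequences.  The Souslin operation gives a closed set [EE] of
   "edges" (sequences of naturals), each recording two codes of [E]-related points together with
   a witness, such that any two [E]-related points are joined by an edge.  Finite sums of edges
   modulo 2 form, level by level, a countable group of chains; let [Base] be the product of
   these groups, with the metric of first difference.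

   The space attached to a code [a] is [Base] with hairs: a chain [g] at level [n] carries a
   hair labelled by [u | n] when the boundary of [g] is [a + u] at level [n].  The hair starts at
   height about [2^-n] and ends at height about [2^-k], where [k] is the number of edges in [g]; its
   label is the number of points of the hair which are limits of isolated points.

   If an edge joins [a] to [b], adding it to all chains maps the space of [a] onto that of [b],
   changing the numbers [k] by at most one: a Lipschitz isomorphism.  Conversely, a
   homeomorphism preserves hairs and their labels.  The hairs of the zero chain, labelled [a | n], are
   closer and closer to one point of [Base] but reach up to height 1; hence their images converge to a
   point of [Base] and carry boundedly many edges.  The limit is a sum of finitely many genuine
   edges with boundary [a + b], and since every edge stays within one class, [a] and [b] code
   equivalent points.

   All these spaces are cut out of one fixed Polish space, by conditions on finitely many bits of
   [a] for each hair, so one isometric embedding of that space into the Urysohn space yields the Borel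
   map.

   For analyticity of uniform homeomorphism, the witness codes approximations to corresponding dense
   sequences of the two spaces, and moduli of uniform continuity in both directions. *)

Open Scope nat_scope.

(** * Agreement of sequences up to a level, and parities of finite lists *)

Definition agree {K : Type} (n : nat) (a b : nat -> K) : Prop :=
  forall i, i < n -> a i = b i.

Lemma agree_refl {K} n (a : nat -> K) : agree n a a.
Proof. easy. Qed.

Lemma agree_sym {K} n (a b : nat -> K) : agree n a b -> agree n b a.
Proof. intros H i Hi. symmetry. auto. Qed.

Lemma agree_trans {K} n (a b c : nat -> K) : agree n a b -> agree n b c -> agree n a c.
Proof. intros H H' i Hi. rewrite H by assumption. auto. Qed.

Lemma agree_le {K} n m (a b : nat -> K) : m <= n -> agree n a b -> agree m a b.
Proof. intros H H' i Hi. apply H'. lia. Qed.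

Lemma agree_all {K} (a b : nat -> K) : (forall n, agree n a b) -> a = b.
Proof. intros H. apply functional_extensionality. intros i. apply (H (S i)). lia. Qed.

Lemma agree_congr {K} n m (v a b : nat -> K) :
  m <= n -> agree n a b -> (agree m v a <-> agree m v b).
Proof.
  intros Hm H. apply (agree_le _ m) in H; [|exact Hm].
  split; intros H'; eapply agree_trans; eauto using agree_sym.
Qed.

Definition dec (P : Prop) : bool := if excluded_middle_informative P then true else false.

Lemma decP P : dec P = true <-> P.
Proof. unfold dec. destruct (excluded_middle_informative P); split; easy. Qed.

Lemma decF P : dec P = false <-> ~ P.
Proof. unfold dec. destruct (excluded_middle_informative P); split; easy. Qed.

Lemma dec_ext P Q : (P <-> Q) -> dec P = dec Q.
Proof.
  intros H. unfold dec.
  destruct (excluded_middle_informative P), (excluded_middle_informative Q); tauto.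
Qed.

(** Entries are counted with multiplicity and modulo two, so a list stands for a finite formal sum
    over the field with two elements, and concatenation for addition. *)
Fixpoint par {K : Type} (P : K -> Prop) (l : list K) : bool :=
  match l with
  | [] => false
  | x :: l' => xorb (dec (P x)) (par P l')
  end.

Lemma par_app {K} (P : K -> Prop) l l' : par P (l ++ l') = xorb (par P l) (par P l').
Proof.
  induction l as [|x l IH]; simpl; [now destruct (par P l')|].
  now rewrite IH, Bool.xorb_assoc_reverse.
Qed.

Lemma par_ext {K} (P Q : K -> Prop) l :
  (forall x, In x l -> (P x <-> Q x)) -> par P l = par Q l.
Proof.
  induction l as [|x l IH]; simpl; intros H; [easy|].
  rewrite IH by auto. f_equal. apply dec_ext. auto.
Qed.

Lemma par_map {K L} (f : K -> L) (P : L -> Prop) l :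
  par P (map f l) = par (fun x => P (f x)) l.
Proof. induction l as [|x l IH]; simpl; now rewrite ?IH. Qed.

Lemma par_mid {K} (P : K -> Prop) l x l' :
  par P (l ++ x :: l') = xorb (dec (P x)) (par P (l ++ l')).
Proof.
  rewrite !par_app. simpl. destruct (par P l), (par P l'), (dec (P x)); easy.
Qed.

Lemma par_in {K} (P : K -> Prop) l : par P l = true -> exists x, In x l /\ P x.
Proof.
  induction l as [|x l IH]; simpl; [easy|]. intros H.
  destruct (dec (P x)) eqn:E.
  - apply (proj1 (decP _)) in E. exists x. auto.
  - destruct IH as [y [Hy HP]]; [now destruct (par P l)|]. exists y. auto.
Qed.

(** Reflexivity and the Euclidean law make [Q] an equivalence relation, and [P] is a union of
    classes. If the head [x] satisfies [P], its class has even parity and so contains a further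
    entry [y]; deleting both changes no parity of a union of classes, and induction on the length
    applies. *)
Lemma par_classes {K} (Q : K -> K -> Prop) (P : K -> Prop) (l : list K) :
  (forall x, Q x x) -> (forall x y z, Q x y -> Q x z -> Q y z) ->
  (forall x y, Q x y -> (P x <-> P y)) ->
  (forall v, P v -> par (Q v) l = false) -> par P l = false.
Proof.
  intros Hr Ht HP. remember (length l) as n eqn:Hn. revert l Hn.
  induction n as [n IH] using (well_founded_induction lt_wf). intros [|x l] Hn H; [easy|].
  destruct (classic (P x)) as [Px|Px].
  - pose proof (H x Px) as Hx. simpl in Hx.
    rewrite (proj2 (decP _) (Hr x)) in Hx.
    destruct (par_in (Q x) l) as [y [Hy Qxy]]; [now destruct (par (Q x) l)|].
    destruct (in_split _ _ Hy) as [l1 [l2 ->]].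
    assert (E : forall R : K -> Prop, (R x <-> R y) ->
        par R (x :: l1 ++ y :: l2) = par R (l1 ++ l2)).
    { intros R HR. simpl. rewrite par_mid, (dec_ext _ _ HR).
      now destruct (dec (R y)), (par R (l1 ++ l2)). }
    rewrite E by now apply HP.
    eapply (IH (length (l1 ++ l2))); [|reflexivity|].
    + simpl in Hn. rewrite length_app in *. simpl in Hn. lia.
    + intros v Pv. rewrite <- E; [now apply H|].
      assert (Hs : forall a b, Q a b -> Q b a) by eauto.
      split; intros Hv; apply Hs; eapply Ht; eauto.
  - simpl. rewrite (proj2 (decF _) Px), Bool.xorb_false_l.
    eapply (IH (length l)); [|reflexivity|].
    + simpl in Hn. lia.
    + intros v Pv. specialize (H v Pv). simpl in H.
      rewrite (proj2 (decF (Q v x))) in H; [now destruct (par (Q v) l)|].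
      intros Hvx. apply Px. now apply (HP v x).
Qed.

Lemma par_agree {K} n (P : (nat -> K) -> Prop) l :
  (forall a b, agree n a b -> (P a <-> P b)) ->
  (forall v, P v -> par (agree n v) l = false) -> par P l = false.
Proof.
  intros HP H. apply (par_classes (agree n)); auto using agree_refl.
  intros x y z Hy Hz. eapply agree_trans; eauto using agree_sym.
Qed.

Lemma agree_separates {K} (Z : list (nat -> K)) :
  exists m, forall a b, In a Z -> In b Z -> agree m a b -> a = b.
Proof.
  assert (H1 : forall c (L : list (nat -> K)),
      exists m, forall b, In b L -> agree m c b -> c = b).
  { intros c L. induction L as [|d L [m IH]]; [now exists 0|].
    destruct (classic (c = d)) as [E|E].
    - exists m. intros b [<-|Hb]; auto.
    - destruct (not_all_ex_not _ _ (fun H => E (agree_all c d H))) as [p Hp].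
      exists (p + m). intros b [<-|Hb] Ha.
      + destruct Hp. eapply agree_le; [|exact Ha]. lia.
      + apply IH; auto. eapply agree_le; [|exact Ha]. lia. }
  induction Z as [|c Z [m IH]]; [now exists 0|].
  destruct (H1 c Z) as [p Hp]. exists (p + m).
  intros a b [<-|Ha] [<-|Hb] Hab; auto.
  - apply Hp; auto. eapply agree_le; [|exact Hab]. lia.
  - symmetry. apply Hp; auto. apply agree_sym. eapply agree_le; [|exact Hab]. lia.
  - apply IH; auto. eapply agree_le; [|exact Hab]. lia.
Qed.

(** The finitely many entries of [Z] are separated at some level [m]; on them [P] agrees with a
    union of cells of that level, and each cell has even parity. *)
Lemma par_limit {K} (P : (nat -> K) -> Prop) (Z : list (nat -> K)) :
  (forall m v, par (agree m v) Z = false) -> par P Z = false.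
Proof.
  intros H. destruct (agree_separates Z) as [m Hm].
  set (P' := fun v => exists a, In a Z /\ agree m v a /\ P a).
  rewrite (par_ext P P').
  - apply (par_agree m); [|auto].
    intros a b Hab. split; intros [c [Hc [Hac Pc]]]; exists c; repeat split; auto;
      eapply agree_trans; eauto using agree_sym.
  - intros a Ha. split.
    + intros Pa. exists a. auto using agree_refl.
    + intros [c [Hc [Hac Pc]]]. now rewrite (Hm a c).
Qed.

(** * Chains modulo two *)

(* The chain [G l], level by level: [G l m e] says whether the cell of [e] at level [m] carries
   an odd number of the edges in [l]. *)
Definition gfun := nat -> (nat -> nat) -> bool.

Definition G (l : list (nat -> nat)) : gfun := fun m e => par (agree m e) l.

Lemma G_congr l m n e e' : m <= n -> agree n e e' -> G l m e = G l m e'.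
Proof.
  intros Hm H. apply par_ext. intros x _. apply agree_le with (m := m) in H; auto.
  split; intros H'; eapply agree_trans; eauto using agree_sym.
Qed.

Section Edges.

Variable EE : (nat -> nat) -> Prop.
Variables src tgt : (nat -> nat) -> nat -> bool.
Hypothesis EE_closed : forall e, (forall n, exists e', EE e' /\ agree n e e') -> EE e.
Hypothesis src_level : forall n e e', agree n e e' -> agree n (src e) (src e').
Hypothesis tgt_level : forall n e e', agree n e e' -> agree n (tgt e) (tgt e').

Definition ends (l : list (nat -> nat)) : list (nat -> bool) := map src l ++ map tgt l.

(* At level [n] the boundary of the chain [l] is the sum of the points of [Z]. *)
Definition bd (n : nat) (Z : list (nat -> bool)) (l : list (nat -> nat)) : Prop :=
  forall v, par (agree n v) (ends l ++ Z) = false.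

Lemma bd_le n m Z l : m <= n -> bd n Z l -> bd m Z l.
Proof.
  intros Hm H v. apply (par_agree n).
  - intros a b. now apply agree_congr.
  - intros w _. apply H.
Qed.

(** The cells of [l ++ l'] at level [n] are all even. Since source and target respect levels, a cell
    of endpoints pulls back to a union of cells of edges, which is then even too. *)
Lemma par_ends_G n l l' v :
  (forall e, G l n e = G l' n e) ->
  par (agree n v) (ends l) = par (agree n v) (ends l').
Proof.
  intros H.
  assert (E : forall f : (nat -> nat) -> nat -> bool,
      (forall n e e', agree n e e' -> agree n (f e) (f e')) ->
      par (agree n v) (map f l) = par (agree n v) (map f l')).
  { intros f Hf. rewrite !par_map.
    assert (E : par (fun x => agree n v (f x)) (l ++ l') = false).
    { apply (par_agree n).
      - intros a b Hab. apply agree_congr with (n := n); auto.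
      - intros e _. rewrite par_app. specialize (H e). unfold G in H.
        rewrite H. apply Bool.xorb_nilpotent. }
    rewrite par_app in E. now apply Bool.xorb_eq in E. }
  unfold ends. rewrite !par_app. now rewrite !E.
Qed.

Lemma bd_G n Z l l' : (forall e, G l n e = G l' n e) -> bd n Z l -> bd n Z l'.
Proof.
  intros H Hb v. rewrite par_app, <- (par_ends_G n l l' v H). specialize (Hb v). now rewrite par_app in Hb.
Qed.

Lemma ends_mid (P : (nat -> bool) -> Prop) l1 e l2 Z :
  par P (ends (l1 ++ e :: l2) ++ Z) = par P (ends (l1 ++ l2) ++ src e :: tgt e :: Z).
Proof.
  unfold ends. rewrite !map_app. simpl. rewrite !par_app. simpl.
  repeat match goal with |- context [par P ?a] => destruct (par P a) end;
    destruct (dec (P (src e))), (dec (P (tgt e))); easy.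
Qed.

(** The parity of a cell is the sum of the parities of its subcells at the next level, of which only
    finitely many are odd; so an odd cell contains an odd subcell, and repeated choice yields a
    branch. *)
Lemma branch_exists (g : gfun) j e :
  (forall m, exists l, forall i, i <= m -> forall e, g i e = G l i e) ->
  g j e = true ->
  exists b, forall m, j <= m -> g m b = true.
Proof.
  intros Hg He.
  assert (step : forall i a, g i a = true -> exists a', agree i a a' /\ g (S i) a' = true).
  { intros i a Ha. apply NNPP. intros Hno. destruct (Hg (S i)) as [l Hl].
    rewrite Hl in Ha by lia. unfold G in Ha.
    rewrite (par_agree (S i)) in Ha; [easy| |].
    - intros x y Hxy. apply agree_congr with (n := S i); auto.
    - intros v Hv. destruct (par (agree (S i) v) l) eqn:E; [|easy].
      destruct Hno. exists v. split; auto. now rewrite Hl. }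
  set (f := fun i a => epsilon (inhabits a) (fun a' => agree i a a' /\ g (S i) a' = true)).
  set (s := nat_rect (fun _ => nat -> nat) e (fun n a => f (j + n) a)).
  assert (Hs : forall n, g (j + n) (s n) = true /\ agree (j + n) (s n) (s (S n))).
  { assert (Hf : forall n, g (j + n) (s n) = true ->
        agree (j + n) (s n) (s (S n)) /\ g (S (j + n)) (s (S n)) = true).
    { intros n H. apply (epsilon_spec (inhabits (s n)) _ (step _ _ H)). }
    induction n as [|n IH].
    - rewrite Nat.add_0_r. split; [exact He|].
      specialize (Hf 0). rewrite Nat.add_0_r in Hf. now apply Hf.
    - destruct IH as [IH _]. apply Hf in IH. destruct IH as [_ IH].
      rewrite <- Nat.add_succ_r in IH. split; [exact IH|]. now apply Hf. }
  assert (Hst : forall p n, agree (j + n) (s n) (s (n + p))).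
  { induction p as [|p IH]; intros n; [rewrite Nat.add_0_r; apply agree_refl|].
    eapply agree_trans; [apply IH|]. rewrite Nat.add_succ_r.
    eapply agree_le; [|apply Hs]. lia. }
  (* Stage [n] is frozen below [j + n], so entry [i] is final at stage [S i]. *)
  exists (fun i => s (S i) i).
  intros m Hm. destruct (Hs (m - j)) as [H _].
  replace (j + (m - j)) with m in H by lia.
  destruct (Hg m) as [l Hl]. rewrite Hl in * by lia. rewrite <- H.
  apply (G_congr l m m); auto. intros i Hi.
  destruct (le_lt_dec (m - j) (S i)) as [Hc|Hc].
  - symmetry. replace (S i) with ((m - j) + (S i - (m - j))) by lia. apply Hst. lia.
  - replace (m - j) with (S i + (m - j - S i)) by lia. apply Hst. lia.
Qed.

(* A coherent chain with at most [k] cells at every level is a sum of at most [k] genuine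
   edges; they are split off one at a time, adding their endpoints to [Z]. *)
Lemma limit_chain (P : (nat -> bool) -> Prop) :
  (forall e, EE e -> (P (src e) <-> P (tgt e))) ->
  forall k (g : gfun) Z,
  (forall m, exists l, length l <= k /\ Forall EE l /\
      (forall j, j <= m -> forall e, g j e = G l j e) /\ bd m Z l) ->
  par P Z = false.
Proof.
  intros HP k. induction k as [|k IH]; intros g Z Hg.
  - apply par_limit. intros m v. destruct (Hg m) as [l [Hl [_ [_ Hb]]]].
    destruct l; [|simpl in Hl; lia]. apply (Hb v).
  - destruct (classic (exists j e, g j e = true)) as [[j [e He]]|Hno].
    (* An odd cell of [g] lies on a branch [b] of odd cells. Each approximating chain has an edge in
       the cell of [b], so [b] is a limit of edges and, by closedness, an edge. *)
    + destruct (branch_exists g j e) as [b Hb]; [|exact He|].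
      { intros m. destruct (Hg m) as [l Hl]. exists l. apply Hl. }
      assert (Hfind : forall m, j <= m -> exists l1 x l2, length (l1 ++ l2) <= k /\
          Forall EE (l1 ++ x :: l2) /\ agree m b x /\
          (forall i, i <= m -> forall e, g i e = G (l1 ++ x :: l2) i e) /\
          bd m Z (l1 ++ x :: l2)).
      { intros m Hm. destruct (Hg m) as [l [Hlen [HE [Hl Hbd]]]].
        specialize (Hb m Hm). rewrite Hl in Hb by lia. unfold G in Hb.
        apply par_in in Hb. destruct Hb as [x [Hx Hbx]].
        destruct (in_split _ _ Hx) as [l1 [l2 ->]]. exists l1, x, l2.
        rewrite length_app in *. simpl in Hlen. repeat split; auto. lia. }
      assert (Eb : EE b).
      { apply EE_closed. intros n. destruct (Hfind (j + n)) as [l1 [x [l2 [_ [HE [Hx _]]]]]]; [lia|].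
        exists x. split; [|eapply agree_le; [|exact Hx]; lia].
        rewrite Forall_forall in HE. apply HE. apply in_elt. }
      (* Toggling the cells of [b] corresponds to deleting [x], and the endpoints of [b] and [x]
         agree to the level considered. *)
      specialize (IH (fun m e => xorb (g m e) (dec (agree m e b))) (src b :: tgt b :: Z)).
      assert (HZ : par P (src b :: tgt b :: Z) = false).
      { apply IH. intros m.
        destruct (Hfind (j + m)) as [l1 [x [l2 [Hlen [HE [Hx [Hl Hbd]]]]]]]; [lia|].
        exists (l1 ++ l2). split; [exact Hlen|]. split; [|split].
        - rewrite Forall_forall in *. intros y Hy. apply HE.
          apply in_app_iff in Hy. apply in_app_iff. simpl. tauto.
        - intros i Hi a. rewrite Hl by lia. unfold G. rewrite par_mid.
          rewrite (dec_ext (agree i a b) (agree i a x)).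
          2:{ apply agree_congr with (n := j + m); auto. lia. }
          now destruct (dec (agree i a x)), (par (agree i a) (l1 ++ l2)).
        - intros v. apply (bd_le _ m) in Hbd; [|lia].
          rewrite <- (Hbd v), ends_mid.
          apply (agree_le _ m) in Hx; [|lia].
          rewrite !par_app. simpl.
          f_equal. f_equal; [|f_equal]; apply dec_ext; apply (agree_congr m); auto. }
      simpl in HZ. rewrite (dec_ext _ _ (HP b Eb)) in HZ.
      now destruct (dec (P (tgt b))), (par P Z).
    (* Here [g] vanishes at all levels, so the approximating chain has at level [m] the boundary of
       the empty chain. *)
    + apply par_limit. intros m v. destruct (Hg m) as [l [_ [_ [Hl Hb]]]].
      assert (E : bd m Z []).
      { apply (bd_G m Z l); [|exact Hb]. intros e. rewrite <- Hl by lia.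
        destruct (g m e) eqn:E; [|easy]. destruct Hno. eauto. }
      apply (E v).
Qed.

End Edges.

Close Scope nat_scope.

Tactic Notation "decide_em" "as" simple_intropattern(p) :=
  match goal with
  | |- context [excluded_middle_informative ?P] => destruct (excluded_middle_informative P) as p
  | _ : context [excluded_middle_informative ?P] |- _ => destruct (excluded_middle_informative P) as p
  end.
Tactic Notation "decide_em" := decide_em as [?|?].

(** * Powers of one half and reciprocals of positive integers *)

Lemma half_pow_pos n : 0 < (/2) ^ n.
Proof. apply pow_lt. lra. Qed.

Lemma half_pow_le m n : (m <= n)%nat -> (/2) ^ n <= (/2) ^ m.
Proof.
  intros H. replace n with (m + (n - m))%nat by lia. rewrite pow_add.
  assert (H1 : (/2) ^ (n - m) <= 1).
  { rewrite <- (pow1 (n - m)). apply pow_incr. lra. }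
  pose proof (half_pow_pos m). nra.
Qed.

Lemma half_pow_lt_inv m n : (/2) ^ n < (/2) ^ m -> (m < n)%nat.
Proof.
  intros H. destruct (le_lt_dec n m) as [Hc|Hc]; [|exact Hc].
  apply half_pow_le in Hc. lra.
Qed.

Lemma half_pow_small eps : 0 < eps -> exists n, (/2) ^ n < eps.
Proof.
  intros H. destruct (pow_lt_1_zero (/2)) with (y := eps) as [N HN]; [|exact H|].
  - rewrite Rabs_pos_eq; lra.
  - exists N. specialize (HN N (le_n N)). rewrite Rabs_pos_eq in HN; auto.
    apply Rlt_le, half_pow_pos.
Qed.

Lemma inv_INR_small eps : 0 < eps -> exists n, / INR (S n) < eps.
Proof.
  intros H. destruct (archimed_cor1 eps H) as [N [HN HN']].
  exists (pred N). now replace (S (pred N)) with N by lia.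
Qed.

Lemma inv_INR_pos n : 0 < / INR (S n).
Proof. apply Rinv_0_lt_compat, lt_0_INR. lia. Qed.

Lemma inv_INR_le m n : (m <= n)%nat -> / INR (S n) <= / INR (S m).
Proof. intros H. apply Rinv_le_contravar; [apply lt_0_INR; lia|apply le_INR; lia]. Qed.

Lemma inv_INR_le1 n : / INR (S n) <= 1.
Proof. rewrite <- Rinv_1. apply Rinv_le_contravar; [lra|]. apply (le_INR 1). lia. Qed.

Lemma inv_INR_inj m n : / INR (S m) = / INR (S n) -> m = n.
Proof. intros H. apply Rinv_eq_reg, INR_eq in H. lia. Qed.

Lemma nat_floor x : 0 <= x -> exists a : nat, INR a <= x < INR a + 1.
Proof.
  intros Hx. destruct (archimed x) as [H1 H2].
  assert (H0 : (0 < up x)%Z) by (apply lt_IZR; simpl; lra).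
  exists (Z.to_nat (up x - 1)). rewrite INR_IZR_INZ, Z2Nat.id by lia.
  rewrite minus_IZR. lra.
Qed.

Lemma least_nat (P : nat -> Prop) :
  (exists n, P n) -> exists n, P n /\ forall m, P m -> (n <= m)%nat.
Proof.
  intros [n Hn]. induction n as [n IH] using (well_founded_induction lt_wf).
  destruct (classic (exists m, (m < n)%nat /\ P m)) as [[m [Hm Pm]]|Hno].
  - eauto.
  - exists n. split; auto. intros m Pm. apply Nat.nlt_ge. intros H. apply Hno. eauto.
Qed.

(** * The ultrametric of first difference *)

Definition ud {K : Type} (a b : nat -> K) : R :=
  if excluded_middle_informative (a = b) then 0
  else (/2) ^ epsilon (inhabits O) (fun n => agree n a b /\ a n <> b n).

Lemma ud_spec {K} (a b : nat -> K) :
  a <> b -> exists n, agree n a b /\ a n <> b n /\ ud a b = (/2) ^ n.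
Proof.
  intros H. unfold ud. destruct (excluded_middle_informative (a = b)) as [|_]; [easy|].
  assert (E : exists n, agree n a b /\ a n <> b n).
  { destruct (least_nat (fun n => a n <> b n)) as [n [Hn Hm]].
    - apply NNPP. intros Hno. apply H, functional_extensionality. intros i.
      apply NNPP. eauto.
    - exists n. split; auto. intros i Hi. apply NNPP. intros Hc. specialize (Hm i Hc). lia. }
  pose proof (epsilon_spec (inhabits O) _ E) as [H1 H2]. eauto.
Qed.

Lemma ud_refl {K} (a : nat -> K) : ud a a = 0.
Proof. unfold ud. now destruct (excluded_middle_informative (a = a)). Qed.

Lemma ud_nonneg {K} (a b : nat -> K) : 0 <= ud a b.
Proof.
  destruct (classic (a = b)) as [<-|H]; [rewrite ud_refl; lra|].
  destruct (ud_spec a b H) as [n [_ [_ ->]]]. apply Rlt_le, half_pow_pos.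
Qed.

Lemma ud_eq0 {K} (a b : nat -> K) : ud a b = 0 -> a = b.
Proof.
  intros H. apply NNPP. intros Hn. destruct (ud_spec a b Hn) as [n [_ [_ E]]].
  pose proof (half_pow_pos n). lra.
Qed.

Lemma ud_agree {K} n (a b : nat -> K) : agree n a b <-> ud a b <= (/2) ^ n.
Proof.
  destruct (classic (a = b)) as [<-|H].
  - rewrite ud_refl. split; intros _; [apply Rlt_le, half_pow_pos|apply agree_refl].
  - destruct (ud_spec a b H) as [m [Hm [Hne ->]]]. split.
    + intros Hn. apply half_pow_le. apply Nat.nlt_ge. intros Hc. auto.
    + intros Hle. destruct (le_lt_dec n m) as [Hc|Hc].
      * now apply (agree_le m).
      * assert ((/2) ^ S m <= (/2) ^ m /2) by (simpl; lra).
        pose proof (half_pow_le (S m) n Hc). pose proof (half_pow_pos m). lra.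
Qed.

Lemma ud_sym {K} (a b : nat -> K) : ud a b = ud b a.
Proof.
  assert (H : forall a b : nat -> K, ud a b <= ud b a).
  { intros x y. destruct (classic (y = x)) as [<-|H]; [lra|].
    destruct (ud_spec y x H) as [n [Hn [_ ->]]]. now apply ud_agree, agree_sym. }
  apply Rle_antisym; apply H.
Qed.

Lemma ud_ultra {K} (a b c : nat -> K) r : ud a b <= r -> ud b c <= r -> ud a c <= r.
Proof.
  intros Hab Hbc. apply Rnot_lt_le. intros H.
  destruct (classic (a = c)) as [<-|Hac].
  { rewrite ud_refl in H. pose proof (ud_nonneg a b). lra. }
  destruct (ud_spec a c Hac) as [n [Hn [Hne E]]].
  assert (Hlt : forall x y : nat -> K, ud x y < (/2) ^ n -> x n = y n).
  { intros x y Hxy. destruct (classic (x = y)) as [<-|Hd]; [easy|].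
    destruct (ud_spec x y Hd) as [m [Hm [_ E']]]. apply Hm.
    apply half_pow_lt_inv. lra. }
  apply Hne. transitivity (b n); apply Hlt; lra.
Qed.

Lemma ud_triangle {K} (a b c : nat -> K) : ud a c <= ud a b + ud b c.
Proof.
  pose proof (ud_nonneg a b). pose proof (ud_nonneg b c).
  apply ud_ultra with (b := b); lra.
Qed.

Lemma ud_complete {K} (u : nat -> nat -> K) : cauchy_seq ud u ->
  exists g, converges_to ud u g /\ forall n, exists N, forall m, (N <= m)%nat -> agree n g (u m).
Proof.
  intros Hu.
  assert (H : forall n, exists N, forall m, (N <= m)%nat -> agree n (u N) (u m)).
  { intros n. destruct (Hu ((/2) ^ n) (half_pow_pos n)) as [N HN].
    exists N. intros m Hm. apply ud_agree. apply Rlt_le. auto. }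
  apply choice in H. destruct H as [N HN].
  set (g := fun i => u (N (S i)) i).
  assert (Hg : forall n, exists M, forall m, (M <= m)%nat -> agree n g (u m)).
  { intros n. exists (N n). intros m Hm i Hi.
    unfold g. rewrite (HN (S i) (N (S i) + m)%nat) by lia.
    rewrite <- (HN n m Hm i Hi). symmetry. apply HN; lia. }
  exists g. split; [|exact Hg].
  intros eps Heps. destruct (half_pow_small eps Heps) as [n Hn].
  destruct (Hg n) as [M HM]. exists M. intros m Hm.
  eapply Rle_lt_trans; [|exact Hn]. apply ud_agree, agree_sym. auto.
Qed.

(** * Countable types *)

Definition enumerated (A : Type) : Prop := exists f : nat -> A, forall a, exists n, f n = a.

Lemma enumerated_nat : enumerated nat.
Proof. exists (fun n => n). eauto. Qed.

Lemma enumerated_prod A B : enumerated A -> enumerated B -> enumerated (A * B).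
Proof.
  intros [f Hf] [g Hg].
  exists (fun n => (f (fst (Cantor.of_nat n)), g (snd (Cantor.of_nat n)))).
  intros [a b]. destruct (Hf a) as [i <-]. destruct (Hg b) as [j <-].
  exists (Cantor.to_nat (i, j)). now rewrite Cantor.cancel_of_to.
Qed.

(** A list is coded by its length, the [fuel], and an iterated Cantor pair. *)
Fixpoint decode_list {A : Type} (f : nat -> A) (fuel n : nat) : list A :=
  match fuel with
  | O => []
  | S k => f (fst (Cantor.of_nat n)) :: decode_list f k (snd (Cantor.of_nat n))
  end.

Lemma enumerated_list A : enumerated A -> enumerated (list A).
Proof.
  intros [f Hf].
  exists (fun n => decode_list f (fst (Cantor.of_nat n)) (snd (Cantor.of_nat n))).
  intros l.
  assert (H : exists k n, decode_list f k n = l).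
  { induction l as [|a l [k [n IH]]]; [now exists O, O|].
    destruct (Hf a) as [i <-]. exists (S k), (Cantor.to_nat (i, n)). cbn [decode_list].
    rewrite Cantor.cancel_of_to. cbn [fst snd]. now rewrite IH. }
  destruct H as [k [n <-]]. exists (Cantor.to_nat (k, n)). now rewrite Cantor.cancel_of_to.
Qed.

Definition pad (w : list nat) : nat -> nat := fun i => nth i w O.

(** Up to level [m] a chain sees only the first [m] entries of its edges, which may therefore be cut
    to finite words. Hence the truncated chains form a countable family. *)
Lemma G_words l m : exists w : list (list nat), forall j, (j <= m)%nat -> G (map pad w) j = G l j.
Proof.
  exists (map (fun e => map e (seq 0 m)) l). intros j Hj.
  apply functional_extensionality. intros e. unfold G. rewrite !par_map.
  apply par_ext. intros x _. apply (agree_congr m); auto.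
  intros i Hi. unfold pad. rewrite (nth_indep _ O (x O)) by now rewrite length_map, length_seq.
  rewrite map_nth, seq_nth by exact Hi. reflexivity.
Qed.

(** Levels above [n] are erased, so that equality of truncated chains is plain equality of
    functions. *)
Definition cut (n : nat) (g : gfun) : gfun := fun j => if le_dec j n then g j else fun _ => false.

Lemma cut_cut n g : cut n (cut n g) = cut n g.
Proof. apply functional_extensionality. intros j. unfold cut. now destruct (le_dec j n). Qed.

Lemma cut_ext n g g' : (forall j, (j <= n)%nat -> g j = g' j) -> cut n g = cut n g'.
Proof.
  intros H. apply functional_extensionality. intros j. unfold cut.
  destruct (le_dec j n); auto.
Qed.

Lemma cut_le n g j : (j <= n)%nat -> cut n g j = g j.
Proof. intros H. unfold cut. now destruct (le_dec j n). Qed.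

(** * The universal comb *)

(** [SB g] is a single point of the base; [SH n c g] is a hair of level [n] with label [c], standing
    over the chain [g]. *)
Inductive strand := SB (g : gfun) | SH (n c : nat) (g : gfun).

(* (strand, parameter along the strand, distance from the strand) *)
Definition point : Type := strand * R * R.
Definition sd (q : point) : strand := fst (fst q).
Definition th (q : point) : R := snd (fst q).
Definition sp (q : point) : R := snd q.

Definition att (s : strand) : gfun := match s with SB g => g | SH _ _ g => g end.

(** The start of a hair of level [n]. It is positive, which separates the hair from all other
    strands, and at most half the top, which keeps the hair from degenerating. *)
Definition bot (n : nat) : R := (/2) ^ (S n).

(** No coherence between levels is asked: this is the full product of the groups of finite chains at
    each level. *)
Definition base (g : gfun) : Prop := forall j, exists l, g j = G l j.

Lemma base_cut n l : base (cut n (G l)).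
Proof.
  intros j. unfold cut. destruct (le_dec j n); [eauto|]. exists []. reflexivity.
Qed.

Section Comb.

(* [len n g] stands for the number of edges of the chain [g] at level [n]. *)
Variable len : nat -> gfun -> nat.

(** The cap at [n] keeps the top at least [2 * bot n], however many edges the chain has. *)
Definition htop (n : nat) (g : gfun) : R := (/2) ^ (Nat.min n (len n g)).

Definition height (q : point) : R :=
  match sd q with
  | SB _ => 0
  | SH n _ g => bot n + th q * (htop n g - bot n)
  end.

(* A hair labelled [c] is marked at the parameters [1/(j+1)], [j < c]; each mark is the limit of
   isolated points at distances [bot n/(k+1)]. *)
Definition valid (q : point) : Prop :=
  match sd q with
  | SB g => base g /\ th q = 0 /\ sp q = 0
  | SH n c g => (exists l, g = cut n (G l)) /\ 0 <= th q <= 1 /\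
      (sp q = 0 \/ exists j k, (j < c)%nat /\ th q = / INR (S j) /\ sp q = bot n * / INR (S k))
  end.

(** Along a strand one measures heights; from one strand to another the path descends to the base,
    crosses it and climbs again. *)
Definition dd (q q' : point) : R :=
  if excluded_middle_informative (sd q = sd q') then Rabs (height q - height q')
  else height q + height q' + ud (att (sd q)) (att (sd q')).

(** Each point sits at the end of a spike of length [sp]; a path between distinct points traverses
    both spikes. *)
Definition cdist (q q' : point) : R :=
  if excluded_middle_informative (q = q') then 0 else sp q + sp q' + dd q q'.

Lemma bot_pos n : 0 < bot n.
Proof. apply half_pow_pos. Qed.

Lemma bot_top n g : 2 * bot n <= htop n g.
Proof.
  unfold bot, htop. pose proof (half_pow_le (Nat.min n (len n g)) n (Nat.le_min_l _ _)).
  simpl. lra.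
Qed.

Lemma top_le1 n g : htop n g <= 1.
Proof. apply (half_pow_le 0). lia. Qed.

Lemma ht_range q n c g : valid q -> sd q = SH n c g -> bot n <= height q <= htop n g.
Proof.
  unfold valid, height. intros V E. rewrite E in *. destruct V as [_ [V _]].
  pose proof (bot_top n g). pose proof (bot_pos n). nra.
Qed.

Lemma sp_nonneg q : valid q -> 0 <= sp q.
Proof.
  unfold valid. destruct (sd q) as [g|n c g].
  - intros [_ [_ ->]]. lra.
  - intros [_ [_ [->|[j [k [_ [_ ->]]]]]]]; [lra|].
    pose proof (bot_pos n). pose proof (inv_INR_pos k). nra.
Qed.

Lemma ht_nonneg q : valid q -> 0 <= height q.
Proof.
  intros V. destruct (sd q) as [g|n c g] eqn:E.
  - unfold height. rewrite E. lra.
  - pose proof (ht_range q n c g V E). pose proof (bot_pos n). lra.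
Qed.

Lemma dd_nonneg q q' : valid q -> valid q' -> 0 <= dd q q'.
Proof.
  intros V V'. unfold dd. decide_em; [apply Rabs_pos|].
  pose proof (ht_nonneg q V). pose proof (ht_nonneg q' V').
  pose proof (ud_nonneg (att (sd q)) (att (sd q'))). lra.
Qed.

Lemma dd_sym q q' : dd q q' = dd q' q.
Proof.
  unfold dd. repeat decide_em; try congruence.
  - apply Rabs_minus_sym.
  - rewrite ud_sym. lra.
Qed.

Lemma dd_triangle p q r : valid p -> valid q -> valid r -> dd p r <= dd p q + dd q r.
Proof.
  intros Vp Vq Vr. pose proof (ht_nonneg p Vp). pose proof (ht_nonneg q Vq).
  pose proof (ht_nonneg r Vr). pose proof (ud_nonneg (att (sd p)) (att (sd q))).
  pose proof (ud_nonneg (att (sd q)) (att (sd r))).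
  pose proof (ud_triangle (att (sd p)) (att (sd q)) (att (sd r))).
  unfold dd. repeat decide_em; try congruence;
    repeat match goal with E : sd _ = sd _ |- _ => rewrite E in *; clear E end;
    unfold Rabs in *; repeat destruct Rcase_abs; lra.
Qed.

Lemma D_refl q : cdist q q = 0.
Proof. unfold cdist. now decide_em. Qed.

Lemma D_neq q q' : q <> q' -> cdist q q' = sp q + sp q' + dd q q'.
Proof. unfold cdist. now decide_em. Qed.

Lemma D_nonneg q q' : valid q -> valid q' -> 0 <= cdist q q'.
Proof.
  intros V V'. unfold cdist. decide_em; [lra|].
  pose proof (sp_nonneg q V). pose proof (sp_nonneg q' V').
  pose proof (dd_nonneg q q' V V'). lra.
Qed.

Lemma D_sym q q' : cdist q q' = cdist q' q.
Proof.
  unfold cdist. repeat decide_em; try congruence.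
  rewrite dd_sym. lra.
Qed.

Lemma D_triangle p q r : valid p -> valid q -> valid r -> cdist p r <= cdist p q + cdist q r.
Proof.
  intros Vp Vq Vr. pose proof (sp_nonneg p Vp). pose proof (sp_nonneg q Vq).
  pose proof (sp_nonneg r Vr). pose proof (dd_triangle p q r Vp Vq Vr).
  pose proof (D_nonneg p q Vp Vq). pose proof (D_nonneg q r Vq Vr).
  destruct (classic (p = r)) as [<-|Hpr]; [rewrite D_refl; lra|].
  destruct (classic (p = q)) as [<-|Hpq]; [rewrite D_refl; lra|].
  destruct (classic (q = r)) as [<-|Hqr]; [rewrite D_refl; lra|].
  rewrite !D_neq by assumption. lra.
Qed.

Lemma same_ht_th q q' : valid q -> valid q' -> sd q = sd q' -> height q = height q' -> th q = th q'.
Proof.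
  unfold valid, height. intros V V' E. rewrite <- E in *. destruct (sd q) as [g|n c g]; intros H.
  - destruct V as [_ [-> _]], V' as [_ [-> _]]. reflexivity.
  - pose proof (bot_top n g). pose proof (bot_pos n). nra.
Qed.

Lemma point_eq (q q' : point) : sd q = sd q' -> th q = th q' -> sp q = sp q' -> q = q'.
Proof. destruct q as [[s t] r], q' as [[s' t'] r']. unfold sd, th, sp. simpl. congruence. Qed.

Lemma D_eq0 q q' : valid q -> valid q' -> cdist q q' = 0 -> q = q'.
Proof.
  intros V V' H. apply NNPP. intros Hne. rewrite D_neq in H by assumption.
  pose proof (sp_nonneg q V). pose proof (sp_nonneg q' V').
  pose proof (dd_nonneg q q' V V'). pose proof (ht_nonneg q V). pose proof (ht_nonneg q' V').
  assert (Hd : dd q q' = 0) by lra. unfold dd in Hd.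
  decide_em as [E|E].
  - apply Hne, point_eq; [exact E| |lra]. apply same_ht_th; auto.
    apply Rminus_diag_uniq. apply NNPP. intros Hc. now apply Rabs_no_R0 in Hc.
  - pose proof (ud_nonneg (att (sd q)) (att (sd q'))).
    destruct (sd q) as [g|n c g] eqn:Eq.
    + destruct (sd q') as [g'|n' c' g'] eqn:Eq'.
      * apply E. f_equal. apply ud_eq0. simpl in *. lra.
      * pose proof (ht_range q' n' c' g' V' Eq'). pose proof (bot_pos n'). lra.
    + pose proof (ht_range q n c g V Eq). pose proof (bot_pos n). lra.
Qed.

Lemma D_le q q' : valid q -> valid q' ->
  cdist q q' <= sp q + sp q' + (height q + height q' + ud (att (sd q)) (att (sd q'))).
Proof.
  intros V V'. pose proof (sp_nonneg q V). pose proof (sp_nonneg q' V').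
  pose proof (ht_nonneg q V). pose proof (ht_nonneg q' V').
  pose proof (ud_nonneg (att (sd q)) (att (sd q'))).
  unfold cdist. decide_em; [lra|].
  unfold dd. decide_em; [|lra].
  unfold Rabs. destruct Rcase_abs; lra.
Qed.

Lemma D_ge_ud q q' : valid q -> valid q' -> ud (att (sd q)) (att (sd q')) <= cdist q q'.
Proof.
  intros V V'. pose proof (sp_nonneg q V). pose proof (sp_nonneg q' V').
  pose proof (ht_nonneg q V). pose proof (ht_nonneg q' V').
  unfold cdist. decide_em as [<-|]; [rewrite ud_refl; lra|].
  unfold dd. decide_em as [->|]; [|lra].
  rewrite ud_refl. pose proof (Rabs_pos (height q - height q')). lra.
Qed.

Lemma D_ge_sp q q' : valid q -> valid q' -> q <> q' -> sp q <= cdist q q'.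
Proof.
  intros V V' H. rewrite D_neq by assumption.
  pose proof (sp_nonneg q' V'). pose proof (dd_nonneg q q' V V'). lra.
Qed.

Lemma D_ge_dd q q' : valid q -> valid q' -> dd q q' <= cdist q q'.
Proof.
  intros V V'. unfold cdist. decide_em as [<-|].
  - unfold dd. decide_em; [|easy]. rewrite Rminus_diag, Rabs_R0. lra.
  - pose proof (sp_nonneg q V). pose proof (sp_nonneg q' V'). lra.
Qed.

Lemma D_ge_ht q q' : valid q -> valid q' -> sd q <> sd q' -> height q <= cdist q q'.
Proof.
  intros V V' H. eapply Rle_trans; [|apply D_ge_dd; assumption].
  unfold dd. decide_em; [easy|].
  pose proof (ht_nonneg q' V'). pose proof (ud_nonneg (att (sd q)) (att (sd q'))). lra.
Qed.

Lemma D_ge_ht_diff q q' : valid q -> valid q' -> sd q = sd q' -> Rabs (height q - height q') <= cdist q q'.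
Proof.
  intros V V' H. eapply Rle_trans; [|apply D_ge_dd; assumption].
  unfold dd. decide_em; [lra|easy].
Qed.

Lemma not_tends_to_zero (v : nat -> R) :
  ~ (exists s, 0 < s /\ forall N, exists n, (N <= n)%nat /\ s <= v n) ->
  forall s, 0 < s -> exists N, forall n, (N <= n)%nat -> v n < s.
Proof.
  intros H s Hs. apply NNPP. intros Hno. apply H. exists s. split; auto. intros N.
  apply NNPP. intros Hc. apply Hno. exists N. intros n Hn. apply Rnot_le_lt. eauto.
Qed.

(** The base is always kept, and a hair is kept or dropped as a whole. *)
Definition sub (Pr : nat -> nat -> gfun -> Prop) (q : point) : Prop :=
  valid q /\ match sd q with SB _ => True | SH n c g => Pr n c g end.

(** Three cases. If the spikes do not shrink, the sequence is eventually constant. If the spikes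
    shrink but the heights do not, it eventually stays on one hair and its heights converge.
    Otherwise the attachment points converge in the base, and the limit is a base point, which lies
    in every such subset. *)
Lemma sub_complete Pr (u : nat -> point) :
  (forall n, sub Pr (u n)) -> cauchy_seq cdist u -> exists q, sub Pr q /\ converges_to cdist u q.
Proof.
  intros Hu Hc.
  assert (V : forall n, valid (u n)) by (intros n; apply Hu).
  destruct (classic (exists s, 0 < s /\ forall N, exists n, (N <= n)%nat /\ s <= sp (u n)))
    as [[s [Hs H]]|H].
  { destruct (Hc s Hs) as [N HN]. destruct (H N) as [n [Hn Hsn]].
    exists (u n). split; [apply Hu|]. intros eps Heps. exists N. intros m Hm.
    replace (u m) with (u n); [now rewrite D_refl|].
    apply NNPP. intros Hne. apply (D_ge_sp _ _ (V n) (V m)) in Hne.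
    specialize (HN n m Hn Hm). lra. }
  pose proof (not_tends_to_zero _ H) as Hsp. clear H.
  destruct (classic (exists s, 0 < s /\ forall N, exists n, (N <= n)%nat /\ s <= height (u n)))
    as [[s [Hs H]]|H].
  - destruct (Hc s Hs) as [N HN]. destruct (H N) as [n0 [Hn0 Hsn]]. clear H.
    assert (Es : forall m, (N <= m)%nat -> sd (u m) = sd (u n0)).
    { intros m Hm. apply NNPP. intros Hne.
      pose proof (D_ge_ht _ _ (V n0) (V m) (not_eq_sym Hne)). specialize (HN n0 m Hn0 Hm). lra. }
    destruct (sd (u n0)) as [g|n c g] eqn:E.
    { unfold height in Hsn. rewrite E in Hsn. lra. }
    destruct (Rcomplete.R_complete (fun m => height (u (N + m)%nat))) as [h Hh].
    { intros eps Heps. destruct (Hc eps Heps) as [M HM]. exists M. intros p q Hp Hq.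
      unfold Rdist. eapply Rle_lt_trans; [apply D_ge_ht_diff; auto|].
      - rewrite !Es by lia. reflexivity.
      - apply HM; lia. }
    assert (Hr : bot n <= h <= htop n g).
    { split; apply Rnot_lt_le; intros Hlt.
      - destruct (Hh (bot n - h)) as [M HM]; [lra|]. specialize (HM M (le_n M)).
        pose proof (ht_range _ n c g (V (N + M)%nat) (Es _ (Nat.le_add_r _ _))).
        apply Rabs_def2 in HM. lra.
      - destruct (Hh (h - htop n g)) as [M HM]; [lra|]. specialize (HM M (le_n M)).
        pose proof (ht_range _ n c g (V (N + M)%nat) (Es _ (Nat.le_add_r _ _))).
        apply Rabs_def2 in HM. lra. }
    pose proof (bot_top n g) as Hbt. pose proof (bot_pos n) as Hb.
    set (q := (SH n c g, (h - bot n) / (htop n g - bot n), 0) : point).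
    assert (Hq : height q = h) by (unfold height, th; simpl; field; lra).
    assert (Vq : sub Pr q).
    { specialize (Hu n0). split.
      - unfold valid. simpl. destruct Hu as [Hv _]. unfold valid in Hv. rewrite E in Hv.
        split; [apply Hv|]. split; [|now left]. unfold q, th; simpl. split.
        + apply Rle_mult_inv_pos; lra.
        + apply (Rmult_le_reg_r (htop n g - bot n)); [lra|].
          unfold Rdiv. rewrite Rmult_assoc, Rinv_l; lra.
      - simpl. destruct Hu as [_ Hu]. now rewrite E in Hu. }
    exists q. split; [exact Vq|]. intros eps Heps.
    destruct (Hsp (eps / 2)) as [M1 HM1]; [lra|].
    destruct (Hh (eps / 2)) as [M2 HM2]; [lra|].
    exists (N + M1 + M2)%nat. intros m Hm.
    specialize (HM1 m ltac:(lia)). specialize (HM2 (m - N)%nat ltac:(lia)).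
    replace (N + (m - N))%nat with m in HM2 by lia. unfold Rdist in HM2.
    unfold cdist. decide_em; [lra|].
    unfold dd. decide_em as [_|Hne].
    + rewrite Hq. unfold sp at 2. simpl. lra.
    + destruct Hne. apply Es. lia.
  - pose proof (not_tends_to_zero _ H) as Hht. clear H.
    destruct (ud_complete (fun n => att (sd (u n)))) as [g [Hg Hag]].
    { intros eps Heps. destruct (Hc eps Heps) as [N HN]. exists N. intros m n Hm Hn.
      eapply Rle_lt_trans; [apply D_ge_ud; auto|]. auto. }
    assert (Vq : valid (SB g, 0, 0)).
    { split; [|split; reflexivity]. intros j. destruct (Hag (S j)) as [N HN].
      specialize (HN N (le_n N)). rewrite (HN j) by lia.
      specialize (V N). unfold valid in V. destruct (sd (u N)) as [g'|n c g'].
      - apply V.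
      - destruct V as [[l ->] _]. apply base_cut. }
    exists (SB g, 0, 0). split; [now split|]. intros eps Heps.
    destruct (Hsp (eps / 3)) as [M1 HM1]; [lra|].
    destruct (Hht (eps / 3)) as [M2 HM2]; [lra|].
    destruct (Hg (eps / 3)) as [M3 HM3]; [lra|].
    exists (M1 + M2 + M3)%nat. intros m Hm.
    specialize (HM1 m ltac:(lia)). specialize (HM2 m ltac:(lia)). specialize (HM3 m ltac:(lia)).
    eapply Rle_lt_trans; [apply D_le; auto|].
    unfold height at 2, sp at 2. simpl in *. lra.
Qed.

(** The levels are unrelated, so each needs a list of words of its own. *)
Lemma base_words g n : base g ->
  exists L : list (list (list nat)), agree n g (fun j => G (map pad (nth j L [])) j).
Proof.
  intros Hg. induction n as [|n [L HL]]; [exists []; easy|].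
  destruct (Hg n) as [l Hl]. destruct (G_words l n) as [w Hw].
  exists (map (fun j => nth j L []) (seq 0 n) ++ [w]). intros j Hj.
  destruct (Nat.eq_dec j n) as [->|Hne].
  - rewrite app_nth2; rewrite length_map, length_seq; [|lia].
    rewrite Nat.sub_diag. simpl. now rewrite Hw by lia.
  - rewrite app_nth1 by (rewrite length_map, length_seq; lia).
    rewrite (nth_indep _ [] (nth O L [])) by (rewrite length_map, length_seq; lia).
    rewrite map_nth with (f := fun j => nth j L []), seq_nth by lia. apply HL. lia.
Qed.

Lemma valid_separable :
  exists s : nat -> point, (forall n, valid (s n)) /\
    forall q eps, valid q -> 0 < eps -> exists n, cdist q (s n) < eps.
Proof.
  set (q0 := (SB (fun j => G [] j), 0, 0) : point).
  assert (V0 : valid q0) by (split; [intros j; now exists []|split; reflexivity]).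
  (* [kind] 0 yields base points, 1 points of a hair with parameter [a/(b+1)], any other value the
     isolated points. Codes without a valid point are later sent to the default [q0]. *)
  set (mk := fun x : list (list (list nat)) * list (list nat) * (nat * nat) * (nat * nat) * nat =>
    match x with (L, w, (n, c), (a, b), kind) =>
      match kind with
      | O => (SB (fun j => G (map pad (nth j L [])) j), 0, 0) : point
      | 1%nat => (SH n c (cut n (G (map pad w))), INR a * / INR (S b), 0)
      | _ => (SH n c (cut n (G (map pad w))), / INR (S a), bot n * / INR (S b))
      end
    end).
  assert (En : enumerated (list (list (list nat)) * list (list nat) * (nat * nat) * (nat * nat) * nat)).
  { pose proof enumerated_nat as N. pose proof (enumerated_list _ (enumerated_list _ N)) as L.
    repeat apply enumerated_prod; auto. now apply enumerated_list. }
  destruct En as [f Hf].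
  exists (fun k => if excluded_middle_informative (valid (mk (f k))) then mk (f k) else q0).
  split; [intros k; now decide_em|].
  intros q eps V Heps.
  assert (H : exists x, valid (mk x) /\ cdist q (mk x) < eps).
  2:{ destruct H as [x [Vx Hx]]. destruct (Hf x) as [k <-]. exists k.
      now decide_em. }
  destruct q as [[s t] r]. pose proof V as V'. unfold valid in V'. simpl in V'.
  destruct s as [g|n c g]; unfold sp, th in V'; simpl in V'.
  - destruct V' as [Hg [-> ->]]. destruct (half_pow_small eps Heps) as [n Hn].
    destruct (base_words g n Hg) as [L HL].
    exists (L, [], (O, O), (O, O), O). simpl.
    assert (Vx : valid (SB (fun j => G (map pad (nth j L [])) j), 0, 0)).
    { split; [|split; reflexivity]. intros j. eauto. }
    split; [exact Vx|].
    eapply Rle_lt_trans; [apply D_le; auto|]. unfold height, sp; simpl.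
    apply ud_agree in HL. lra.
  - destruct V' as [[l ->] [Ht Hr]]. destruct (G_words l n) as [w Hw].
    assert (E : cut n (G (map pad w)) = cut n (G l)) by now apply cut_ext.
    destruct Hr as [->|[j [k [Hj [-> ->]]]]].
    + destruct (inv_INR_small eps Heps) as [b Hb].
      (* The parameter is rounded down to a multiple of [1/(b+1)]; a hair is shorter than 1, so the
         distance stays below [eps]. *)
      destruct (nat_floor (t * INR (S b))) as [a Ha].
      { apply Rmult_le_pos; [lra|apply pos_INR]. }
      assert (HS : 0 < INR (S b)) by (apply lt_0_INR; lia).
      pose proof (inv_INR_pos b) as Hi.
      set (t' := INR a * / INR (S b)).
      assert (E' : t = t * INR (S b) * / INR (S b)) by (field; lra).
      assert (Ht' : 0 <= t' <= t /\ t - t' < eps).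
      { unfold t'. rewrite E'. pose proof (pos_INR a). split; [split; nra|].
        rewrite <- Rmult_minus_distr_r. nra. }
      exists ([], w, (n, c), (a, b), 1%nat).
      replace (mk _) with ((SH n c (cut n (G l)), t', 0) : point) by (unfold mk, t'; now rewrite E).
      clearbody t'.
      assert (Vx : valid (SH n c (cut n (G l)), t', 0)).
      { split; [eauto|]. unfold th, sp; simpl. split; [lra|now left]. }
      split; [exact Vx|].
      unfold cdist. decide_em; [lra|].
      unfold dd. decide_em as [_|Hne]; [|easy].
      unfold height, sp, th; simpl.
      pose proof (bot_top n (cut n (G l))). pose proof (bot_pos n).
      pose proof (top_le1 n (cut n (G l))).
      match goal with |- context [Rabs ?x] =>
        replace x with ((t - t') * (htop n (cut n (G l)) - bot n)) by ring end.
      rewrite Rabs_pos_eq; nra.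
    + exists ([], w, (n, c), (j, k), 2%nat). simpl mk. rewrite E. split; [exact V|].
      now rewrite D_refl.
Qed.

End Comb.

(* The leading 1 makes the length [n] recoverable from the code. *)
Fixpoint cd (a : nat -> bool) (n : nat) : nat :=
  match n with
  | O => 1
  | S m => 2 * cd a m + (if a m then 1 else 0)
  end.

Lemma cd_pos a n : (1 <= cd a n)%nat.
Proof. induction n as [|n IH]; simpl; [lia|]. destruct (a n); lia. Qed.

Lemma cd_inj a b n m : cd a n = cd b m -> n = m /\ agree n a b.
Proof.
  revert m. induction n as [|n IH]; intros [|m] H; simpl in H.
  - split; [easy|]. intros i Hi. lia.
  - pose proof (cd_pos b m). destruct (b m); lia.
  - pose proof (cd_pos a n). destruct (a n); lia.
  - destruct (IH m) as [<- Ha]; [destruct (a n), (b m); lia|]. split; [easy|].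
    intros i Hi. destruct (Nat.eq_dec i n) as [->|Hne]; [|apply Ha; lia].
    destruct (a n), (b n); try easy; lia.
Qed.

(** * Connectedness of the interval, counting, and addition of an edge *)

(** Connectedness of [[0,1]]: a jump would turn the condition into a continuous function with values
    1 and -1 only, against the intermediate value theorem. *)
Lemma no_jump (V : R -> Prop) :
  (forall x, 0 <= x <= 1 -> exists del, 0 < del /\
    forall y, 0 <= y <= 1 -> Rabs (y - x) < del -> (V x <-> V y)) ->
  forall x y, 0 <= x <= 1 -> 0 <= y <= 1 -> V x -> V y.
Proof.
  assert (main : forall V : R -> Prop,
      (forall x, 0 <= x <= 1 -> exists del, 0 < del /\
        forall y, 0 <= y <= 1 -> Rabs (y - x) < del -> (V x <-> V y)) ->
      forall x y, 0 <= x <= 1 -> 0 <= y <= 1 -> x < y -> ~ V x -> V y -> False).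
  { clear V. intros V HV x y Hx Hy Hxy Vx Vy.
    (* Clipping to [[0,1]] makes the function continuous on the whole line, as [IVT] demands. *)
    set (c := fun x => Rmax 0 (Rmin 1 x)).
    assert (Hc01 : forall x, 0 <= c x <= 1).
    { intros t. unfold c, Rmax, Rmin. repeat destruct Rle_dec; lra. }
    assert (Hcid : forall x, 0 <= x <= 1 -> c x = x).
    { intros t Ht. unfold c, Rmax, Rmin. repeat destruct Rle_dec; lra. }
    assert (Hclip : forall x y, Rabs (c y - c x) <= Rabs (y - x)).
    { intros t s. unfold c, Rmax, Rmin, Rabs. repeat destruct Rle_dec; repeat destruct Rcase_abs; lra. }
    set (f := fun x => if dec (V (c x)) then 1 else -1).
    destruct (IVT f x y) as [z [_ Hz]]; auto.
    - intros t eps Heps. destruct (HV (c t) (Hc01 t)) as [del [Hd H]].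
      exists del. split; [exact Hd|]. intros s [_ Hs].
      simpl in Hs. unfold Rdist in Hs. simpl. unfold Rdist, f.
      rewrite (dec_ext (V (c t)) (V (c s))).
      + now rewrite Rminus_diag, Rabs_R0.
      + apply H; auto. eapply Rle_lt_trans; [apply Hclip|exact Hs].
    - unfold f. rewrite Hcid by assumption. rewrite (proj2 (decF _) Vx). lra.
    - unfold f. rewrite Hcid by assumption. rewrite (proj2 (decP _) Vy). lra.
    - unfold f in Hz. destruct (dec (V (c z))); lra. }
  intros HV x y Hx Hy Vx. apply NNPP. intros Vy.
  destruct (Rtotal_order x y) as [H|[<-|H]]; [|easy|].
  - apply (main (fun t => ~ V t)) with (x := x) (y := y); auto.
    intros t Ht. destruct (HV t Ht) as [del [Hd H']]. exists del. split; auto.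
    intros s Hs Hst. specialize (H' s Hs Hst). tauto.
  - apply (main V HV y x); auto.
Qed.

Lemma pigeonhole (c c' : nat) (S : nat -> nat -> Prop) :
  (forall j, (j < c)%nat -> exists j', (j' < c')%nat /\ S j j') ->
  (forall i j j', (i < c)%nat -> (j < c)%nat -> S i j' -> S j j' -> i = j) -> (c <= c')%nat.
Proof.
  intros H Hinj.
  assert (Hf : exists f, forall j, (j < c)%nat -> (f j < c')%nat /\ S j (f j)).
  { apply (choice (fun j j' => (j < c)%nat -> (j' < c')%nat /\ S j j')).
    intros j. destruct (le_lt_dec c j) as [Hj|Hj]; [exists O; lia|].
    destruct (H j Hj) as [j' Hj']. eauto. }
  destruct Hf as [f Hf].
  pose proof (NoDup_incl_length (l := map f (seq 0 c)) (l' := seq 0 c')) as L.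
  rewrite length_map, !length_seq in L. apply L.
  - apply NoDup_map_NoDup_ForallPairs; [|apply seq_NoDup].
    intros i j Hi Hj E. apply in_seq in Hi, Hj.
    apply (Hinj i j (f i)); try lia; [|rewrite E]; apply Hf; lia.
  - intros x Hx. apply in_map_iff in Hx. destruct Hx as [j [<- Hj]].
    apply in_seq in Hj. apply in_seq. destruct (Hf j); lia.
Qed.

Lemma finite_gap (t : R) (f : nat -> R) c :
  (forall j, (j < c)%nat -> t <> f j) ->
  exists del, 0 < del /\ forall j, (j < c)%nat -> del <= Rabs (t - f j).
Proof.
  induction c as [|c IH]; intros H.
  - exists 1. split; [lra|]. lia.
  - destruct IH as [del [Hd Hj]]; [auto|].
    assert (Hc : 0 < Rabs (t - f c)).
    { apply Rabs_pos_lt. specialize (H c (Nat.lt_succ_diag_r c)). lra. }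
    exists (Rmin del (Rabs (t - f c))). split; [now apply Rmin_glb_lt|].
    intros j Hlt. destruct (Nat.eq_dec j c) as [->|Hne]; [apply Rmin_r|].
    eapply Rle_trans; [apply Rmin_l|]. apply Hj. lia.
Qed.

(** Addition of the single edge [e] modulo two, at all levels. *)
Definition xg (e : nat -> nat) (g : gfun) : gfun := fun m x => xorb (g m x) (dec (agree m x e)).

Lemma xg_G e l : xg e (G l) = G (e :: l).
Proof.
  apply functional_extensionality. intros m. apply functional_extensionality. intros x.
  unfold xg, G. simpl. apply Bool.xorb_comm.
Qed.

Lemma xg_xg e g : xg e (xg e g) = g.
Proof.
  apply functional_extensionality. intros m. apply functional_extensionality. intros x.
  unfold xg. now destruct (g m x), (dec (agree m x e)).
Qed.

Lemma xg_level e g g' m : g m = g' m -> xg e g m = xg e g' m.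
Proof. intros H. unfold xg. now rewrite H. Qed.

Lemma cut_xg_cut e n g : cut n (xg e (cut n g)) = cut n (xg e g).
Proof. apply cut_ext. intros j Hj. apply xg_level. now apply cut_le. Qed.

Lemma ud_mono {K} (a b a' b' : nat -> K) :
  (forall n, agree n a b -> agree n a' b') -> ud a' b' <= ud a b.
Proof.
  intros H. destruct (classic (a = b)) as [<-|Hne].
  - replace b' with a' by (apply agree_all; intros n; apply H, agree_refl).
    rewrite !ud_refl. lra.
  - destruct (ud_spec a b Hne) as [n [Hn [_ ->]]]. apply ud_agree. auto.
Qed.

(** * The spaces attached to binary codes *)

Section Spaces.

Variable EE : (nat -> nat) -> Prop.
Variables src tgt : (nat -> nat) -> nat -> bool.
Hypothesis EE_closed : forall e, (forall n, exists e', EE e' /\ agree n e e') -> EE e.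
Hypothesis src_level : forall n e e', agree n e e' -> agree n (src e) (src e').
Hypothesis tgt_level : forall n e e', agree n e e' -> agree n (tgt e) (tgt e').

(** Here the edges are genuine, whereas [valid] admits arbitrary sequences; so the set of valid
    points does not depend on [EE]. *)
Definition edge_chain (n : nat) (g : gfun) (l : list (nat -> nat)) : Prop :=
  Forall EE l /\ g = cut n (G l).

(** The least number of genuine edges representing [g]; the value is unspecified when there is no
    representation, which never happens for a hair that is present. *)
Definition elen (n : nat) (g : gfun) : nat :=
  epsilon (inhabits O) (fun k => (exists l, edge_chain n g l /\ length l = k) /\
    forall l, edge_chain n g l -> (k <= length l)%nat).

Lemma elen_spec n g l : edge_chain n g l ->
  (exists l', edge_chain n g l' /\ length l' = elen n g) /\ (elen n g <= length l)%nat.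
Proof.
  intros Hl.
  assert (E : exists k, (exists l, edge_chain n g l /\ length l = k) /\
      forall l, edge_chain n g l -> (k <= length l)%nat).
  { destruct (least_nat (fun k => exists l, edge_chain n g l /\ length l = k)) as [k [Hk Hm]].
    - eauto.
    - exists k. split; eauto. }
  destruct (epsilon_spec (inhabits O) _ E) as [H1 H2]. split; [exact H1|]. now apply H2.
Qed.

Definition present (a : nat -> bool) (n c : nat) (g : gfun) : Prop :=
  exists l, edge_chain n g l /\ exists u, c = cd u n /\ bd src tgt n [a; u] l.

Definition X (a : nat -> bool) : point -> Prop := sub (present a).

Notation ht := (height elen).
Notation D := (cdist elen).
Notation top := (htop elen).

Lemma present_agree a a' n c g : agree n a a' -> present a n c g -> present a' n c g.
Proof.
  intros H [l [Hl [u [Hc Hb]]]]. exists l. split; [exact Hl|]. exists u. split; [exact Hc|].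
  intros v. rewrite <- (Hb v), !par_app. f_equal. simpl. f_equal.
  apply dec_ext. apply (agree_congr n); auto using agree_sym.
Qed.

(** ** Translation along an edge *)

(** Labels and parameters are kept, so each hair is stretched linearly onto the hair of the shifted
    chain. *)
Definition tr (e : nat -> nat) (q : point) : point :=
  match sd q with
  | SB g => (SB (xg e g), th q, sp q)
  | SH n c g => (SH n c (cut n (xg e g)), th q, sp q)
  end.

Lemma tr_th e q : th (tr e q) = th q.
Proof. unfold tr. now destruct (sd q). Qed.

Lemma tr_sp e q : sp (tr e q) = sp q.
Proof. unfold tr. now destruct (sd q). Qed.

Lemma tr_sd e q : sd (tr e q) =
  match sd q with SB g => SB (xg e g) | SH n c g => SH n c (cut n (xg e g)) end.
Proof. unfold tr. now destruct (sd q). Qed.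

Lemma tr_valid e q : valid q -> valid (tr e q).
Proof.
  intros V. unfold valid in *. rewrite tr_sd, tr_th, tr_sp.
  destruct (sd q) as [g|n c g].
  - destruct V as [Hg V]. split; [|exact V]. intros j. destruct (Hg j) as [l Hl].
    exists (e :: l). rewrite <- xg_G. now apply xg_level.
  - destruct V as [[l ->] V]. split; [|exact V]. exists (e :: l).
    now rewrite cut_xg_cut, xg_G.
Qed.

Lemma edge_chain_xg e n g l : EE e -> edge_chain n g l ->
  edge_chain n (cut n (xg e g)) (e :: l).
Proof.
  intros He [Hl ->]. split; [now constructor|]. now rewrite cut_xg_cut, xg_G.
Qed.

(** The boundary of [e] is the sum of its endpoints, so adding [e] turns [a + u] into [b + u] modulo
    two. *)
Lemma bd_shift e a b n u l :
  (a = src e /\ b = tgt e) \/ (a = tgt e /\ b = src e) ->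
  bd src tgt n [a; u] l -> bd src tgt n [b; u] (e :: l).
Proof.
  intros H Hb v. change (e :: l) with ([] ++ e :: l). rewrite ends_mid.
  rewrite <- (Hb v). simpl app. rewrite !par_app. f_equal. simpl.
  destruct H as [[-> ->]|[-> ->]];
    destruct (dec (agree n v (src e))), (dec (agree n v (tgt e))), (dec (agree n v u)); easy.
Qed.

Lemma tr_X e a b q : EE e -> (a = src e /\ b = tgt e) \/ (a = tgt e /\ b = src e) ->
  X a q -> X b (tr e q).
Proof.
  intros He H [V Hp]. split; [now apply tr_valid|]. rewrite tr_sd.
  destruct (sd q) as [g|n c g]; [easy|].
  destruct Hp as [l [Hl [u [Hc Hb]]]].
  exists (e :: l). split; [now apply edge_chain_xg|]. exists u. split; [exact Hc|].
  now apply (bd_shift e a).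
Qed.

Lemma tr_tr e q : valid q -> tr e (tr e q) = q.
Proof.
  intros V. apply point_eq; rewrite ?tr_th, ?tr_sp; auto.
  rewrite !tr_sd. unfold valid in V. destruct (sd q) as [g|n c g].
  - now rewrite xg_xg.
  - destruct V as [[l ->] _]. now rewrite cut_xg_cut, xg_xg, cut_cut.
Qed.

(** Adding [e] to a shortest representation of the shifted chain represents [g] again, so the number
    of edges of [g] exceeds that of the shifted chain by at most one. *)
Lemma top_xg e n g l : EE e -> edge_chain n g l -> top n (cut n (xg e g)) <= 2 * top n g.
Proof.
  intros He Hl. pose proof (edge_chain_xg e n g l He Hl) as Hl'.
  destruct (elen_spec _ _ _ Hl') as [[l1 [H1 E1]] _].
  pose proof (edge_chain_xg e n _ l1 He H1) as H2.
  assert (E : cut n (xg e (cut n (xg e g))) = g).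
  { destruct Hl as [_ ->]. now rewrite cut_xg_cut, xg_xg, cut_cut. }
  rewrite E in H2. destruct (elen_spec _ _ _ H2) as [_ H3]. simpl in H3. rewrite E1 in H3.
  unfold htop.
  pose proof (half_pow_le (Nat.min n (elen n g)) (S (Nat.min n (elen n (cut n (xg e g)))))) as H.
  specialize (H ltac:(lia)). simpl in H. lra.
Qed.

Lemma tr_ht e a q : EE e -> X a q -> ht (tr e q) <= 2 * ht q.
Proof.
  intros He [V Hp]. unfold height. rewrite tr_sd, tr_th. unfold valid in V.
  destruct (sd q) as [g|n c g]; [lra|].
  destruct Hp as [l [Hl _]], V as [_ [V _]].
  pose proof (top_xg e n g l He Hl). pose proof (bot_pos n). nra.
Qed.

(** Truncation at level [n] moves the attachment point by at most [bot n], a lower bound for the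
    heights on the hair. *)
Lemma tr_att e q : valid q -> ud (att (sd (tr e q))) (xg e (att (sd q))) <= ht q.
Proof.
  intros V. pose proof (ht_nonneg elen q V) as H0. rewrite tr_sd.
  destruct (sd q) as [g|n c g] eqn:E; simpl; [now rewrite ud_refl|].
  eapply Rle_trans; [|apply (ht_range elen q n c g V E)].
  apply ud_agree. intros i Hi. apply cut_le. lia.
Qed.

(** On one hair, [top >= 2 * bot] bounds the stretching [(2 * top - bot) / (top - bot)] by 3.
    Between strands, heights at most double, and each attachment point deviates from its image under
    a base isometry by at most the height: again a factor 3. *)
Lemma tr_lipschitz e a q q' : EE e -> X a q -> X a q' -> D (tr e q) (tr e q') <= 3 * D q q'.
Proof.
  intros He Hq Hq'. pose proof (proj1 Hq) as V. pose proof (proj1 Hq') as V'.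
  destruct (classic (q = q')) as [<-|Hne]; [rewrite !D_refl; lra|].
  rewrite (D_neq elen q q') by exact Hne.
  pose proof (sp_nonneg q V). pose proof (sp_nonneg q' V').
  pose proof (ht_nonneg elen q V). pose proof (ht_nonneg elen q' V').
  pose proof (tr_ht e a q He Hq). pose proof (tr_ht e a q' He Hq').
  unfold dd. decide_em as [E|E].
  - destruct (classic (tr e q = tr e q')) as [->|Ht].
    { rewrite D_refl. pose proof (Rabs_pos (ht q - ht q')). lra. }
    rewrite D_neq by exact Ht. rewrite !tr_sp. unfold dd.
    assert (E' : sd (tr e q) = sd (tr e q')) by now rewrite !tr_sd, E.
    decide_em; [|easy].
    assert (Rabs (ht (tr e q) - ht (tr e q')) <= 3 * Rabs (ht q - ht q')); [|lra].
    unfold height. rewrite !tr_sd, !tr_th, <- E. destruct Hq as [_ Hp].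
    destruct (sd q) as [g|n c g]; [rewrite Rminus_diag, Rabs_R0; lra|].
    destruct Hp as [l [Hl _]]. pose proof (top_xg e n g l He Hl).
    pose proof (bot_top elen n g). pose proof (bot_pos n).
    pose proof (bot_top elen n (cut n (xg e g))).
    replace (bot n + th q * (top n (cut n (xg e g)) - bot n) -
      (bot n + th q' * (top n (cut n (xg e g)) - bot n)))
      with ((th q - th q') * (top n (cut n (xg e g)) - bot n)) by ring.
    replace (bot n + th q * (top n g - bot n) - (bot n + th q' * (top n g - bot n)))
      with ((th q - th q') * (top n g - bot n)) by ring.
    rewrite !Rabs_mult. rewrite (Rabs_pos_eq (top n g - bot n)) by lra.
    rewrite (Rabs_pos_eq (top n (cut n (xg e g)) - bot n)) by lra.
    pose proof (Rabs_pos (th q - th q')). nra.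
  - eapply Rle_trans; [apply D_le; now apply tr_valid|]. rewrite !tr_sp.
    pose proof (tr_att e q V) as A. pose proof (tr_att e q' V') as A'.
    pose proof (ud_triangle (att (sd (tr e q))) (xg e (att (sd q))) (att (sd (tr e q')))) as T1.
    pose proof (ud_triangle (xg e (att (sd q))) (xg e (att (sd q'))) (att (sd (tr e q')))) as T2.
    rewrite (ud_sym (xg e (att (sd q'))) (att (sd (tr e q')))) in T2.
    assert (T3 : ud (xg e (att (sd q))) (xg e (att (sd q'))) <= ud (att (sd q)) (att (sd q'))).
    { apply ud_mono. intros n Hn i Hi. apply xg_level. auto. }
    pose proof (ud_nonneg (att (sd q)) (att (sd q'))). lra.
Qed.

(** ** Homeomorphisms between the spaces *)

Definition rel_continuous (A : point -> Prop) (h : point -> point) : Prop :=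
  forall q eps, A q -> 0 < eps -> exists del, 0 < del /\
    forall q', A q' -> D q q' < del -> D (h q) (h q') < eps.

Definition rel_homeo (A B : point -> Prop) (h k : point -> point) : Prop :=
  (forall q, A q -> B (h q) /\ k (h q) = q) /\ (forall q, B q -> A (k q) /\ h (k q) = q) /\
  rel_continuous A h /\ rel_continuous B k.

Lemma rel_homeo_sym A B h k : rel_homeo A B h k -> rel_homeo B A k h.
Proof. unfold rel_homeo. tauto. Qed.

Definition isolated (A : point -> Prop) (q : point) : Prop :=
  A q /\ exists eps, 0 < eps /\ forall q', A q' -> D q q' < eps -> q' = q.

Definition lim_isolated (A : point -> Prop) (q : point) : Prop :=
  forall eps, 0 < eps -> exists q', isolated A q' /\ D q q' < eps.

Lemma homeo_isolated A B h k q : rel_homeo A B h k -> isolated A q -> isolated B (h q).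
Proof.
  intros (Hh & Hk & Ch & Ck) [Aq [eps [Heps Hq]]].
  destruct (Hh q Aq) as [Bq Eq]. split; [exact Bq|].
  destruct (Ck (h q) eps Bq Heps) as [del [Hd H]]. exists del. split; [exact Hd|].
  intros q' Bq' Hlt. destruct (Hk q' Bq') as [Ak <-]. f_equal. apply Hq; [exact Ak|].
  rewrite <- Eq at 1. auto.
Qed.

Lemma homeo_lim_isolated A B h k q :
  rel_homeo A B h k -> A q -> lim_isolated A q -> lim_isolated B (h q).
Proof.
  intros H Aq Hq eps Heps. pose proof H as (Hh & Hk & Ch & Ck).
  destruct (Ch q eps Aq Heps) as [del [Hd H']]. destruct (Hq del Hd) as [q' [Hi Hlt]].
  exists (h q'). split; [eapply homeo_isolated; eauto|]. apply H'; [apply Hi|exact Hlt].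
Qed.

(** Every other strand is at distance at least the height of [q], hence at least [bot n]. *)
Lemma X_same_strand a q q' n c g : X a q -> X a q' -> sd q = SH n c g ->
  D q q' < bot n -> sd q' = sd q.
Proof.
  intros [V _] [V' _] E H. apply NNPP. intros Hne.
  pose proof (D_ge_ht elen q q' V V' (not_eq_sym Hne)).
  pose proof (ht_range elen q n c g V E). lra.
Qed.

Lemma sp_isolated a q : X a q -> 0 < sp q -> isolated (X a) q.
Proof.
  intros Hq Hs. split; [exact Hq|]. exists (sp q). split; [exact Hs|].
  intros q' Hq' Hlt. apply NNPP. intros Hne.
  pose proof (D_ge_sp elen q q' (proj1 Hq) (proj1 Hq') (not_eq_sym Hne)). lra.
Qed.

Definition hair (n c : nat) (g : gfun) (t : R) : point := (SH n c g, t, 0).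

Lemma hair_X a n c g t : present a n c g -> 0 <= t <= 1 -> X a (hair n c g t).
Proof.
  intros Hp Ht. split; [|exact Hp]. destruct Hp as [l [[_ Hl] _]].
  split; [eauto|]. split; [exact Ht|now left].
Qed.

Lemma hair_D n c g t t' :
  D (hair n c g t) (hair n c g t') = Rabs (t' - t) * (top n g - bot n).
Proof.
  unfold cdist. decide_em as [E|E].
  - injection E as ->. rewrite Rminus_diag, Rabs_R0. ring.
  - unfold dd. decide_em; [|easy]. unfold height, hair, sp, th. simpl.
    replace (bot n + t * (top n g - bot n) - (bot n + t' * (top n g - bot n)))
      with (- ((t' - t) * (top n g - bot n))) by ring.
    rewrite Rabs_Ropp, Rabs_mult. pose proof (bot_top elen n g). pose proof (bot_pos n).
    rewrite (Rabs_pos_eq (top n g - bot n)) by lra. ring.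
Qed.

Lemma hair_eq a q n c g : X a q -> sd q = SH n c g -> sp q = 0 -> q = hair n c g (th q).
Proof. intros Hq E Hs. apply point_eq; auto. Qed.

Lemma hair_not_isolated a n c g t : present a n c g -> 0 <= t <= 1 ->
  ~ isolated (X a) (hair n c g t).
Proof.
  intros Hp Ht [_ [eps [Heps H]]].
  pose proof (bot_top elen n g). pose proof (bot_pos n). pose proof (top_le1 elen n g).
  (* A step of length [m], at most one half, fits inside [[0,1]] on at least one side of [t]. *)
  set (m := Rmin (eps / 2) (/2)).
  assert (Hm : 0 < m <= /2 /\ m <= eps / 2).
  { unfold m. split; [split|]; [apply Rmin_glb_lt; lra|apply Rmin_r|apply Rmin_l]. }
  assert (main : forall t', 0 <= t' <= 1 -> t' <> t -> Rabs (t' - t) = m -> False).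
  { intros t' Ht' Hne Hr. specialize (H (hair n c g t') (hair_X a n c g t' Hp Ht')).
    rewrite hair_D, Hr in H. assert (Hlt : m * (top n g - bot n) < eps) by nra.
    specialize (H Hlt). injection H as ->. easy. }
  destruct (Rle_dec t (/2)).
  - apply (main (t + m)); try lra. rewrite Rabs_pos_eq; lra.
  - apply (main (t - m)); try lra. rewrite Rabs_left; lra.
Qed.

(** An isolated point near a point of the hair has the same strand but sits off it, hence at one of
    finitely many marks, and a parameter that is no mark keeps a positive distance from all of them.
    Conversely the points off a mark are isolated and converge to it. *)
Lemma hair_lim_isolated a n c g t : present a n c g -> 0 <= t <= 1 ->
  (lim_isolated (X a) (hair n c g t) <-> exists j, (j < c)%nat /\ t = / INR (S j)).
Proof.
  intros Hp Ht. pose proof (bot_top elen n g) as Hbt. pose proof (bot_pos n) as Hb. split.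
  - intros Hlim. apply NNPP. intros Hno.
    destruct (finite_gap t (fun j => / INR (S j)) c) as [del [Hd Hdel]].
    { intros j Hj E. apply Hno. eauto. }
    destruct (Hlim (Rmin (bot n) (del * (top n g - bot n)))) as [q [Hi Hlt]].
    { apply Rmin_glb_lt; [lra|nra]. }
    pose proof (Rmin_l (bot n) (del * (top n g - bot n))).
    pose proof (Rmin_r (bot n) (del * (top n g - bot n))).
    pose proof (proj1 Hi) as Xq.
    pose proof (hair_X a n c g t Hp Ht) as Xt.
    assert (Es : sd q = SH n c g).
    { apply (X_same_strand a (hair n c g t) q n c g Xt Xq eq_refl). lra. }
    pose proof (proj1 Xq) as Vq. unfold valid in Vq. rewrite Es in Vq.
    destruct Vq as [_ [Hthq [Hs|[j [k [Hj [Ej _]]]]]]].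
    + rewrite (hair_eq a q n c g Xq Es Hs) in Hi. now apply hair_not_isolated in Hi.
    + specialize (Hdel j Hj). cbv beta in Hdel.
      pose proof (D_ge_ht_diff elen _ q (proj1 Xt) (proj1 Xq) (eq_sym Es)) as Hge.
      unfold height in Hge. rewrite Es in Hge. unfold hair at 1 2 in Hge. cbn [sd fst] in Hge.
      unfold th at 1 in Hge. cbn [fst snd] in Hge.
      replace (bot n + t * (top n g - bot n) - (bot n + th q * (top n g - bot n)))
        with ((t - th q) * (top n g - bot n)) in Hge by ring.
      rewrite Rabs_mult, (Rabs_pos_eq (top n g - bot n)) in Hge by lra.
      rewrite Ej in Hge. apply (Rmult_le_compat_r (top n g - bot n)) in Hdel; lra.
  - intros [j [Hj ->]] eps Heps.
    destruct (inv_INR_small eps Heps) as [k Hk].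
    set (q := (SH n c g, / INR (S j), bot n * / INR (S k)) : point).
    pose proof (inv_INR_pos k). pose proof (inv_INR_pos j). pose proof (inv_INR_le1 j).
    assert (Hs : 0 < bot n * / INR (S k)) by nra.
    assert (Xq : X a q).
    { split; [|exact Hp]. destruct Hp as [l [[_ Hl] _]]. split; [eauto|].
      split; [unfold q, th; cbn [fst snd]; lra|]. right. exists j, k. auto. }
    exists q. split; [apply sp_isolated; auto|].
    assert (Hne : hair n c g (/ INR (S j)) <> q).
    { intros E. apply (f_equal sp) in E. unfold sp, hair, q in E. cbn [snd] in E. lra. }
    rewrite D_neq by exact Hne. unfold dd.
    decide_em as [_|Hf]; [|easy].
    replace (ht (hair n c g (/ INR (S j))) - ht q) with 0 by (unfold height, hair, q, th; cbn; ring).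
    rewrite Rabs_R0. unfold sp, hair, q. cbn [snd].
    assert (bot n <= 1) by (pose proof (top_le1 elen n g); lra). nra.
Qed.

(** The hair is a continuous image of [[0,1]], so a condition that is locally constant on the target
    space cannot change along its image. *)
Lemma homeo_path_const a b h k n c g (W : point -> Prop) :
  rel_homeo (X a) (X b) h k -> present a n c g ->
  (forall q, X b q -> exists eps, 0 < eps /\ forall q', X b q' -> D q q' < eps -> (W q <-> W q')) ->
  forall t t', 0 <= t <= 1 -> 0 <= t' <= 1 -> W (h (hair n c g t)) -> W (h (hair n c g t')).
Proof.
  intros (Hh & Hk & Ch & Ck) Hp HW.
  apply (no_jump (fun t => W (h (hair n c g t)))).
  intros x Hx. pose proof (hair_X a n c g x Hp Hx) as Xx.
  destruct (HW (h (hair n c g x)) (proj1 (Hh _ Xx))) as [eps [Heps HWe]].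
  destruct (Ch _ eps Xx Heps) as [del [Hd H]].
  exists del. split; [exact Hd|]. intros y Hy Hlt. pose proof (hair_X a n c g y Hp Hy) as Xy.
  apply HWe; [apply (Hh _ Xy)|]. apply H; [exact Xy|]. rewrite hair_D.
  pose proof (bot_top elen n g). pose proof (bot_pos n). pose proof (top_le1 elen n g).
  pose proof (Rabs_pos (y - x)). nra.
Qed.

(** The image of the hair is connected and not a single point. It therefore avoids the points with
    [sp > 0], which are isolated. A single hair is clopen in the space, so one point on it forces
    the whole image into it; and the base, being ultrametric, has no connected subset with two
    points. *)
Lemma homeo_hair_path a b h k n c g : rel_homeo (X a) (X b) h k -> present a n c g ->
  exists n' c' g', present b n' c' g' /\
    forall t, 0 <= t <= 1 -> sd (h (hair n c g t)) = SH n' c' g' /\ sp (h (hair n c g t)) = 0.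
Proof.
  intros H Hp. pose proof H as (Hh & Hk & Ch & Ck).
  assert (HX : forall t, 0 <= t <= 1 -> X b (h (hair n c g t))).
  { intros t Ht. apply Hh, hair_X; auto. }
  assert (Hinj : h (hair n c g 0) <> h (hair n c g 1)).
  { intros E. apply (f_equal k) in E.
    rewrite (proj2 (Hh _ (hair_X a n c g 0 Hp ltac:(lra)))) in E.
    rewrite (proj2 (Hh _ (hair_X a n c g 1 Hp ltac:(lra)))) in E.
    injection E. intros. lra. }
  assert (Hsp : forall t, 0 <= t <= 1 -> sp (h (hair n c g t)) = 0).
  { intros t Ht. apply NNPP. intros Hs. set (q := h (hair n c g t)) in *.
    pose proof (sp_nonneg q (proj1 (HX t Ht))) as Hs0.
    apply Hinj.
    assert (Hc : forall t', 0 <= t' <= 1 -> h (hair n c g t') = q).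
    { intros t' Ht'. apply (homeo_path_const a b h k n c g (fun p => p = q) H Hp) with (t := t); auto.
      intros p Xp. exists (sp q). split; [lra|]. intros p' Xp' Hlt.
      split; intros ->; apply NNPP; intros Hne.
      - pose proof (D_ge_sp elen q p' (proj1 Xp) (proj1 Xp') (not_eq_sym Hne)). lra.
      - pose proof (D_ge_sp elen q p (proj1 Xp') (proj1 Xp) (not_eq_sym Hne)).
        rewrite D_sym in Hlt. lra. }
    rewrite !Hc by lra. reflexivity. }
  destruct (classic (exists t n' c' g', 0 <= t <= 1 /\ sd (h (hair n c g t)) = SH n' c' g'))
    as [[t [n' [c' [g' [Ht E]]]]]|Hno].
  - exists n', c', g'. split.
    + destruct (HX t Ht) as [_ Hb]. now rewrite E in Hb.
    + intros t' Ht'. split; [|auto].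
      apply (homeo_path_const a b h k n c g (fun p => sd p = SH n' c' g') H Hp) with (t := t); auto.
      intros p Xp. destruct (sd p) as [g0|m d g0] eqn:Ep.
      * exists (bot n'). split; [apply bot_pos|]. intros p' Xp' Hlt. split; [easy|]. intros E'.
        rewrite D_sym in Hlt. pose proof (X_same_strand b p' p n' c' g' Xp' Xp E' Hlt). congruence.
      * exists (bot m). split; [apply bot_pos|]. intros p' Xp' Hlt.
        rewrite (X_same_strand b p p' m d g0 Xp Xp' Ep Hlt), Ep. easy.
  - destruct Hinj.
    assert (HB : forall t, 0 <= t <= 1 -> exists g', h (hair n c g t) = (SB g', 0, 0)).
    { intros t Ht. destruct (sd (h (hair n c g t))) as [g'|n' c' g'] eqn:E.
      - exists g'. destruct (HX t Ht) as [V _]. unfold valid in V. rewrite E in V.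
        destruct V as [_ [V1 V2]]. apply point_eq; auto.
      - destruct Hno. exists t, n', c', g'. auto. }
    destruct (HB 0 ltac:(lra)) as [g0 E0]. destruct (HB 1 ltac:(lra)) as [g1 E1].
    rewrite E0, E1. f_equal. f_equal. f_equal. apply NNPP. intros Hne.
    (* The open ball of radius [r] about [g0] is clopen and misses [g1]. *)
    set (r := ud g1 g0).
    assert (Hr : 0 < r).
    { pose proof (ud_nonneg g1 g0). destruct (Req_dec (ud g1 g0) 0) as [E|E]; [|unfold r; lra].
      apply ud_eq0 in E. congruence. }
    assert (Hu : forall x y z : gfun, ud x y < r -> ud y z < r -> ud x z < r).
    { intros x y z Hxy Hyz. eapply Rle_lt_trans; [|apply (Rmax_lub_lt _ _ _ Hxy Hyz)].
      apply ud_ultra with (b := y); [apply Rmax_l|apply Rmax_r]. }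
    assert (Hf : ud (att (sd (h (hair n c g 1)))) g0 < r).
    { apply (homeo_path_const a b h k n c g (fun p => ud (att (sd p)) g0 < r) H Hp) with (t := 0);
        try lra.
      - intros p Xp. exists r. split; [exact Hr|]. intros p' Xp' Hlt.
        pose proof (D_ge_ud elen p p' (proj1 Xp) (proj1 Xp')) as Hd.
        split; intros Hp'; eapply Hu; eauto; [rewrite ud_sym|]; lra.
      - rewrite E0. simpl. rewrite ud_refl. exact Hr. }
    rewrite E1 in Hf. simpl in Hf. fold r in Hf. lra.
Qed.

(** Marks are the points of a hair that are limits of isolated points, so a homeomorphism maps them
    injectively to marks. *)
Lemma homeo_label_le a b h k n c g n' c' g' : rel_homeo (X a) (X b) h k ->
  present a n c g -> present b n' c' g' ->
  (forall t, 0 <= t <= 1 -> sd (h (hair n c g t)) = SH n' c' g' /\ sp (h (hair n c g t)) = 0) ->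
  (c <= c')%nat.
Proof.
  intros H Hp Hp' Hpath. pose proof H as (Hh & Hk & Ch & Ck).
  assert (H01 : forall j, 0 <= / INR (S j) <= 1).
  { intros j. pose proof (inv_INR_pos j). pose proof (inv_INR_le1 j). lra. }
  apply (pigeonhole c c' (fun j j' => h (hair n c g (/ INR (S j))) = hair n' c' g' (/ INR (S j')))).
  - intros j Hj. pose proof (hair_X a n c g _ Hp (H01 j)) as Xj.
    destruct (Hpath _ (H01 j)) as [E Es]. pose proof (proj1 (Hh _ Xj)) as Xh.
    assert (L : lim_isolated (X a) (hair n c g (/ INR (S j)))).
    { apply hair_lim_isolated; eauto. }
    apply (homeo_lim_isolated _ _ _ _ _ H Xj) in L.
    pose proof (hair_eq b _ _ _ _ Xh E Es) as Eh. rewrite Eh in L.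
    apply hair_lim_isolated in L; [|exact Hp'|].
    + destruct L as [j' [Hj' E']]. exists j'. split; [exact Hj'|]. now rewrite Eh, E'.
    + destruct Xh as [V _]. unfold valid in V. rewrite E in V. apply V.
  - intros i j j' Hi Hj Ei Ej. rewrite <- Ej in Ei. apply (f_equal k) in Ei.
    rewrite (proj2 (Hh _ (hair_X a n c g _ Hp (H01 i)))) in Ei.
    rewrite (proj2 (Hh _ (hair_X a n c g _ Hp (H01 j)))) in Ei.
    injection Ei as Ei. now apply inv_INR_inj.
Qed.

Lemma homeo_label a b h k n c g : rel_homeo (X a) (X b) h k -> present a n c g ->
  exists n' g', present b n' c g' /\
    forall t, 0 <= t <= 1 -> sd (h (hair n c g t)) = SH n' c g' /\ sp (h (hair n c g t)) = 0.
Proof.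
  intros H Hp. destruct (homeo_hair_path a b h k n c g H Hp) as [n' [c' [g' [Hp' Hpath]]]].
  pose proof (rel_homeo_sym _ _ _ _ H) as H'.
  destruct (homeo_hair_path b a k h n' c' g' H' Hp') as [n2 [c2 [g2 [Hp2 Hpath2]]]].
  (* The inverse carries the image hair into a hair that meets the original one, hence is the
     original. *)
  assert (E : SH n2 c2 g2 = SH n c g).
  { pose proof (hair_X a n c g 0 Hp ltac:(lra)) as X0.
    destruct (proj1 H _ X0) as [Xh Ek]. destruct (Hpath 0 ltac:(lra)) as [E Es].
    rewrite (hair_eq b _ _ _ _ Xh E Es) in Ek.
    destruct (Hpath2 (th (h (hair n c g 0)))) as [E2 _].
    - destruct Xh as [V _]. unfold valid in V. rewrite E in V. apply V.
    - rewrite Ek in E2. simpl in E2. now symmetry. }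
  injection E as -> -> ->.
  pose proof (homeo_label_le a b h k _ _ _ _ _ _ H Hp Hp' Hpath).
  pose proof (homeo_label_le b a k h _ _ _ _ _ _ H' Hp' Hp2 Hpath2).
  replace c' with c in * by lia. eauto.
Qed.

(** Taking [u = a] makes the required boundary [a + a = 0]. *)
Lemma zero_hair a n : present a n (cd a n) (G []).
Proof.
  exists []. split.
  - split; [constructor|]. apply functional_extensionality. intros j. unfold cut.
    now destruct (le_dec j n).
  - exists a. split; [easy|]. intros v. simpl. now destruct (dec (agree n v a)).
Qed.

Lemma zero_top n : top n (G []) = 1.
Proof.
  assert (H : edge_chain n (G []) []).
  { split; [constructor|]. apply functional_extensionality. intros j. unfold cut.
    now destruct (le_dec j n). }
  apply elen_spec in H. destruct H as [_ H]. simpl in H. unfold htop.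
  replace (Nat.min n (elen n (G []))) with O by lia. reflexivity.
Qed.

(** The predicate [P] stands for a set of codes that no edge enters or leaves. A limit chain of
    genuine edges with boundary [a + b] shows that [P] holds at both or neither of [a], [b]. *)
Lemma homeo_invariant a b h k (P : (nat -> bool) -> Prop) :
  rel_homeo (X a) (X b) h k -> (forall e, EE e -> (P (src e) <-> P (tgt e))) -> (P a <-> P b).
Proof.
  intros H HP. pose proof H as (Hh & Hk & Ch & Ck).
  assert (H1 : forall n, exists g, present b n (cd a n) g /\
      (exists l, edge_chain n g l /\ bd src tgt n [b; a] l) /\
      forall t, 0 <= t <= 1 -> sd (h (hair n (cd a n) (G []) t)) = SH n (cd a n) g /\
        sp (h (hair n (cd a n) (G []) t)) = 0).
  { intros n. destruct (homeo_label a b h k n _ _ H (zero_hair a n)) as [n' [g [Hp Hpath]]].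
    pose proof Hp as [l [Hl [u [Ec Hb]]]].
    (* The preserved label determines the level and the first [n] bits of [u], so the image chain
       has boundary [b + a] at level [n]. *)
    destruct (cd_inj _ _ _ _ Ec) as [<- Hu].
    exists g. split; [exact Hp|]. split; [|exact Hpath]. exists l. split; [exact Hl|].
    intros v. rewrite <- (Hb v), !par_app. f_equal. simpl. f_equal. f_equal.
    apply dec_ext. now apply (agree_congr n). }
  apply choice in H1. destruct H1 as [gs Hgs].
  set (p := fun n t => hair n (cd a n) (G []) t).
  assert (Hpath : forall n t, 0 <= t <= 1 ->
      sd (h (p n t)) = SH n (cd a n) (gs n) /\ sp (h (p n t)) = 0) by (intros n; apply Hgs).
  assert (Hp : forall n t, 0 <= t <= 1 -> X a (p n t)).
  { intros n t Ht. apply hair_X; [apply zero_hair|exact Ht]. }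
  set (o := (SB (G []), 0, 0) : point).
  assert (Ho : X a o).
  { split; [|easy]. split; [intros j; now exists []|split; reflexivity]. }
  destruct (Hh o Ho) as [Xz Ez]. set (z := h o) in *.
  assert (Hlim : forall eps, 0 < eps -> exists N, forall n, (N <= n)%nat -> D z (h (p n 0)) < eps).
  { intros eps Heps. destruct (Ch o eps Ho Heps) as [del [Hd Hdel]].
    destruct (half_pow_small del Hd) as [N HN]. exists N. intros n Hn.
    apply Hdel; [apply Hp; lra|].
    eapply Rle_lt_trans; [apply D_le; [apply Ho|apply Hp; lra]|].
    unfold sp, height, o, p, hair, th, bot. cbn [fst snd sd att]. rewrite ud_refl.
    pose proof (half_pow_le N (S n) ltac:(lia)). lra. }
  destruct (sd z) as [g|n0 c0 g0] eqn:Esz.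
  (* A limit on a hair would capture the images for all large [n], although these lie on hairs of
     different levels. *)
  2:{ exfalso. destruct (Hlim (bot n0) (bot_pos n0)) as [N HN].
      assert (Hs : forall n, (N <= n)%nat -> n = n0).
      { intros n Hn. specialize (HN n Hn).
        apply (X_same_strand b _ _ _ _ _ Xz (proj1 (Hh _ (Hp n 0 ltac:(lra)))) Esz) in HN.
        rewrite (proj1 (Hpath n 0 ltac:(lra))) in HN. congruence. }
      pose proof (Hs N (le_n N)). pose proof (Hs (S N) ltac:(lia)). lia. }
  assert (Hg : forall eps, 0 < eps -> exists N, forall n, (N <= n)%nat -> ud g (gs n) < eps).
  { intros eps Heps. destruct (Hlim eps Heps) as [N HN]. exists N. intros n Hn.
    eapply Rle_lt_trans; [|apply (HN n Hn)].
    pose proof (D_ge_ud elen z (h (p n 0)) (proj1 Xz) (proj1 (proj1 (Hh _ (Hp n 0 ltac:(lra)))))) as Hd.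
    now rewrite Esz, (proj1 (Hpath n 0 ltac:(lra))) in Hd. }
  (* The tops of the hairs stay away from [o], so their images stay away from [z]. *)
  destruct (Ck z 1 Xz Rlt_0_1) as [del [Hd Hdel]].
  assert (Htop : forall n, del <= top n (gs n) + ud g (gs n)).
  { intros n. pose proof (Hp n 1 ltac:(lra)) as X1. destruct (Hh _ X1) as [Xh Ek].
    destruct (Hpath n 1 ltac:(lra)) as [Es Hs].
    assert (Hge : del <= D z (h (p n 1))).
    { apply Rnot_lt_le. intros Hlt. specialize (Hdel _ Xh Hlt). rewrite Ez, Ek, D_sym in Hdel.
      pose proof (D_ge_ht elen (p n 1) o (proj1 X1) (proj1 Ho) ltac:(easy)) as Hge.
      replace (ht (p n 1)) with 1 in Hge; [lra|].
      unfold height, p, hair, th. cbn [fst snd sd]. rewrite zero_top. ring. }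
    eapply Rle_trans; [exact Hge|].
    eapply Rle_trans; [apply D_le; [apply Xz|apply Xh]|].
    pose proof (ht_range elen _ _ _ _ (proj1 Xh) Es). rewrite Hs, Es, Esz.
    assert (sp z = 0 /\ ht z = 0) as [-> ->].
    { destruct Xz as [V _]. unfold valid in V. unfold height. rewrite Esz in *. split; [apply V|easy]. }
    cbn [att]. lra. }
  (* For [n >= K], a top above [2^-K] can only come from fewer than [K] edges. *)
  destruct (half_pow_small (del / 2)) as [K HK]; [lra|].
  destruct (Hg (del / 2)) as [N1 HN1]; [lra|].
  assert (Hlen : forall n, (N1 <= n)%nat -> (K <= n)%nat -> (elen n (gs n) <= K)%nat).
  { intros n Hn1 HnK. specialize (Htop n). specialize (HN1 n Hn1).
    assert (E : (/2) ^ K < top n (gs n)) by lra.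
    apply half_pow_lt_inv in E. lia. }
  assert (HZ : par P [b; a] = false).
  { apply (limit_chain EE src tgt EE_closed src_level tgt_level P HP K g).
    intros m. destruct (Hg ((/2) ^ S m) (half_pow_pos _)) as [N2 HN2].
    set (n := (N1 + N2 + K + m)%nat).
    destruct (Hgs n) as [_ [[l [Hl Hb]] _]].
    destruct (elen_spec n (gs n) l Hl) as [[l0 [Hl0 El0]] _].
    exists l0. split; [rewrite El0; apply Hlen; lia|]. split; [apply Hl0|].
    assert (Hgn : agree (S m) g (gs n)).
    { apply ud_agree. apply Rlt_le, HN2. lia. }
    split.
    - intros j Hj e. rewrite (Hgn j) by lia. rewrite (proj2 Hl0), cut_le by lia. reflexivity.
    (* [l] and the shortest chain [l0] coincide at level [n], so the boundary known for [l] passes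
       to [l0]. *)
    - apply (bd_le src tgt n); [lia|]. apply (bd_G src tgt src_level tgt_level n _ l); [|exact Hb].
      intros e. pose proof (f_equal (fun f => f n e) (proj2 Hl)) as E1.
      pose proof (f_equal (fun f => f n e) (proj2 Hl0)) as E2. cbv beta in E1, E2.
      rewrite cut_le in E1, E2 by lia. congruence. }
  simpl in HZ. rewrite <- (decP (P a)), <- (decP (P b)).
  now destruct (dec (P a)), (dec (P b)).
Qed.

End Spaces.

(** * Sigma-algebras *)

Lemma sigma_gen_sa {X} (B : set X -> Prop) : is_sigma_algebra (sigma_gen B).
Proof.
  repeat split.
  - intros S HS HB. apply HS.
  - intros A HA S HS HB. pose proof HS as (_ & H & _). apply H. now apply HA.
  - intros A HA S HS HB. pose proof HS as (_ & _ & H & _). apply H. intros n. now apply HA.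
  - intros A A' E HA S HS HB. pose proof HS as (_ & _ & _ & H). apply (H A); [exact E|now apply HA].
Qed.

Lemma sigma_gen_in {X} (B : set X -> Prop) A : B A -> sigma_gen B A.
Proof. intros H S _ HB. auto. Qed.

Section SigmaAlgebra.

Context {X : Type} {S : set X -> Prop} (HS : is_sigma_algebra S).

Lemma sa_ext A B : (forall x, A x <-> B x) -> S A -> S B.
Proof. destruct HS as (_ & _ & _ & H). apply H. Qed.

Lemma sa_not A : S A -> S (fun x => ~ A x).
Proof. destruct HS as (_ & H & _). apply H. Qed.

Lemma sa_ex (A : nat -> set X) : (forall n, S (A n)) -> S (fun x => exists n, A n x).
Proof. destruct HS as (_ & _ & H & _). apply H. Qed.

Lemma sa_all (A : nat -> set X) : (forall n, S (A n)) -> S (fun x => forall n, A n x).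
Proof.
  intros H. apply (sa_ext (fun x => ~ exists n, ~ A n x)).
  - intros x. split; [|firstorder]. intros Hx n. apply NNPP. eauto.
  - apply sa_not, (sa_ex (fun n x => ~ A n x)). intros n. now apply sa_not.
Qed.

Lemma sa_prop (P : Prop) : S (fun _ => P).
Proof.
  destruct (classic P) as [H|H].
  - apply (sa_ext (fun _ => ~ False)); [easy|]. apply sa_not, HS.
  - apply (sa_ext (fun _ => False)); [easy|]. apply HS.
Qed.

Lemma sa_or A B : S A -> S B -> S (fun x => A x \/ B x).
Proof.
  intros HA HB. apply (sa_ext (fun x => exists n : nat, match n with O => A x | _ => B x end)).
  - intros x. split.
    + intros [[|n] H]; auto.
    + intros [H|H]; [now exists O|now exists 1%nat].
  - apply (sa_ex (fun n x => match n with O => A x | _ => B x end)). now intros [|n].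
Qed.

Lemma sa_and A B : S A -> S B -> S (fun x => A x /\ B x).
Proof.
  intros HA HB. apply (sa_ext (fun x => ~ (~ A x \/ ~ B x))); [intros x; tauto|].
  now apply sa_not, sa_or; apply sa_not.
Qed.

Lemma sa_imp A B : S A -> S B -> S (fun x => A x -> B x).
Proof.
  intros HA HB. apply (sa_ext (fun x => ~ A x \/ B x)); [intros x; tauto|].
  apply sa_or; [|exact HB]. now apply sa_not.
Qed.

Lemma sa_exists_enum {I} (A : I -> set X) :
  enumerated I -> (forall i, S (A i)) -> S (fun x => exists i, A i x).
Proof.
  intros [f Hf] H. apply (sa_ext (fun x => exists n, A (f n) x)).
  - intros x. split; [intros [n Hn]; eauto|]. intros [i Hi]. destruct (Hf i) as [n <-]. eauto.
  - apply (sa_ex (fun n => A (f n))). auto.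
Qed.

Lemma sa_gen (B : set X -> Prop) : (forall A, B A -> S A) -> forall A, sigma_gen B A -> S A.
Proof. intros H A HA. now apply HA. Qed.

Lemma sa_preimage_gen {Z} (f : X -> Z) (B : set Z -> Prop) :
  (forall A, B A -> S (fun x => A (f x))) ->
  forall A, sigma_gen B A -> S (fun x => A (f x)).
Proof.
  intros H A HA. apply (HA (fun A => S (fun x => A (f x)))); [|exact H].
  repeat split.
  - apply HS.
  - intros A' HA'. now apply sa_not.
  - intros A' HA'. now apply (sa_ex (fun n x => A' n (f x))).
  - intros A1 A2 E H1. apply (sa_ext (fun x => A1 (f x))); auto.
Qed.

(** Induction on [n]: splitting on the last relevant bit and substituting its value leaves a
    condition on fewer bits. *)
Lemma sa_bits (a : X -> nat -> bool) : (forall i, S (fun x => a x i = true)) ->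
  forall n (P : (nat -> bool) -> Prop), (forall u v, agree n u v -> P u -> P v) ->
  S (fun x => P (a x)).
Proof.
  intros Ha n. induction n as [|n IH]; intros P HP.
  - apply (sa_ext (fun _ => P (fun _ => true))); [|apply sa_prop].
    intros x. split; apply HP; intros i Hi; lia.
  - set (upd := fun b (u : nat -> bool) i => if Nat.eq_dec i n then b else u i).
    assert (HU : forall b, S (fun x => P (upd b (a x)))).
    { intros b. apply (IH (fun u => P (upd b u))). intros u v Huv. apply HP.
      intros i Hi. unfold upd. destruct (Nat.eq_dec i n); [easy|]. apply Huv. lia. }
    apply (sa_ext (fun x => (a x n = true /\ P (upd true (a x))) \/
                            (~ a x n = true /\ P (upd false (a x))))).
    + intros x.
      assert (E : upd (a x n) (a x) = a x).
      { apply functional_extensionality. intros i. unfold upd.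
        now destruct (Nat.eq_dec i n) as [->|]. }
      destruct (a x n) eqn:Ex; rewrite E; intuition congruence.
    + apply sa_or; apply sa_and; auto. now apply sa_not.
Qed.

End SigmaAlgebra.

Lemma prod_sigma_min {X Z} (SX : set X -> Prop) (SZ : set Z -> Prop) (S : set (X * Z) -> Prop) :
  is_sigma_algebra S ->
  (forall A, SX A -> S (fun p => A (fst p))) -> (forall B, SZ B -> S (fun p => B (snd p))) ->
  forall C, prod_sigma SX SZ C -> S C.
Proof.
  intros HS HX HZ. apply sa_gen; [exact HS|]. intros C [A [B [HA [HB H]]]].
  apply (sa_ext HS (fun p => A (fst p) /\ B (snd p))); [intros p; now rewrite H|].
  apply sa_and; auto.
Qed.

Lemma prod_sigma_fst {X Z} (SX : set X -> Prop) (SZ : set Z -> Prop) A :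
  is_sigma_algebra SZ -> SX A -> prod_sigma SX SZ (fun p => A (fst p)).
Proof.
  intros HZ HA. apply sigma_gen_in. exists A, (fun _ => True). split; [exact HA|].
  split; [now apply sa_prop|]. tauto.
Qed.

Lemma prod_sigma_snd {X Z} (SX : set X -> Prop) (SZ : set Z -> Prop) B :
  is_sigma_algebra SX -> SZ B -> prod_sigma SX SZ (fun p => B (snd p)).
Proof.
  intros HX HB. apply sigma_gen_in. exists (fun _ => True), B. split; [now apply sa_prop|].
  split; [exact HB|]. tauto.
Qed.

(** * The Souslin operation *)

Definition slice {K} (k : nat) (w : nat -> K) : nat -> K := fun m => w (to_nat (k, m)).

Definition join {K} (F : nat -> nat -> K) : nat -> K :=
  fun i => F (fst (of_nat i)) (snd (of_nat i)).

Lemma slice_join {K} k (F : nat -> nat -> K) : slice k (join F) = F k.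
Proof.
  apply functional_extensionality. intros m. unfold slice, join. now rewrite cancel_of_to.
Qed.

Lemma bounded_below (f : nat -> nat) m : exists N, forall i, (i < m)%nat -> (f i < N)%nat.
Proof.
  induction m as [|m [N IH]]; [exists O; lia|]. exists (N + S (f m))%nat. intros i Hi.
  destruct (Nat.eq_dec i m) as [->|]; [lia|]. specialize (IH i). lia.
Qed.

Lemma agree_reindex (f : nat -> nat) m : exists N, forall K (w w' : nat -> K),
  agree N w w' -> agree m (fun i => w (f i)) (fun i => w' (f i)).
Proof. destruct (bounded_below f m) as [N HN]. exists N. intros K w w' H i Hi. auto. Qed.

Lemma agree_slice k m : exists N, forall K (w w' : nat -> K),
  agree N w w' -> agree m (slice k w) (slice k w').
Proof. apply (agree_reindex (fun i => to_nat (k, i))). Qed.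

(** Closedness in the product topology, phrased by approximation to every finite level. *)
Definition closed2 (Q : (nat -> nat) -> (nat -> bool) -> Prop) : Prop :=
  forall w a, (forall n, exists w' a', Q w' a' /\ agree n w w' /\ agree n a a') -> Q w a.

Definition bits {X} (U : nat -> set X) (x : X) : nat -> bool := fun i => dec (U i x).

(** Membership in [A] is read off the bit sequence of [x], which must lie in the projection of a
    closed set; these are the results of the Souslin operation on the sets [U i] and their
    complements. *)
Definition suslin {X} (U : nat -> set X) (A : set X) : Prop :=
  exists Q, closed2 Q /\ forall x, A x <-> exists w, Q w (bits U x).

(** The first entry of the witness names [n]; the rest is a witness for [A n]. *)
Lemma suslin_ex {X} (U : nat -> set X) (A : nat -> set X) :
  (forall n, suslin U (A n)) -> suslin U (fun x => exists n, A n x).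
Proof.
  intros H. apply choice in H. destruct H as [Q HQ].
  exists (fun w a => Q (w O) (fun i => w (S i)) a). split.
  - intros w a Hw. apply HQ. intros n. destruct (Hw (S n)) as [w' [a' [Hq [Hww Haa]]]].
    rewrite <- (Hww O) in Hq by lia. exists (fun i => w' (S i)), a'. split; [exact Hq|].
    split; [|eapply agree_le; [|exact Haa]; lia]. intros i Hi. apply Hww. lia.
  - intros x. split.
    + intros [n Hn]. apply HQ in Hn. destruct Hn as [w Hw].
      now exists (fun i => match i with O => n | S j => w j end).
    + intros [w Hw]. exists (w O). apply HQ. eauto.
Qed.

(** The slices of one witness serve all [n] at once; each initial segment of a slice depends on
    finitely many entries, which preserves closedness. *)
Lemma suslin_all {X} (U : nat -> set X) (A : nat -> set X) :
  (forall n, suslin U (A n)) -> suslin U (fun x => forall n, A n x).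
Proof.
  intros H. apply choice in H. destruct H as [Q HQ].
  exists (fun w a => forall n, Q n (slice n w) a). split.
  - intros w a Hw n. apply HQ. intros m. destruct (agree_slice n m) as [N HN].
    destruct (Hw (N + m)%nat) as [w' [a' [Hq [Hww Haa]]]].
    exists (slice n w'), a'. split; [apply Hq|]. split.
    + apply HN. eapply agree_le; [|exact Hww]. lia.
    + eapply agree_le; [|exact Haa]. lia.
  - intros x. split.
    + intros Hx.
      assert (Hw : forall n, exists w, Q n w (bits U x)) by (intros n; now apply HQ).
      apply choice in Hw. destruct Hw as [F HF]. exists (join F). intros n.
      now rewrite slice_join.
    + intros [w Hw] n. apply HQ. eauto.
Qed.

Lemma suslin_ext {X} (U : nat -> set X) A B :
  (forall x, A x <-> B x) -> suslin U A -> suslin U B.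
Proof.
  intros E [Q [HQ H]]. exists Q. split; [exact HQ|]. intros x. now rewrite <- E.
Qed.

Lemma suslin_bit {X} (U : nat -> set X) (A : set X) i b :
  (forall x, A x <-> bits U x i = b) -> suslin U A.
Proof.
  intros H. exists (fun _ a => a i = b). split.
  - intros w a Hw. destruct (Hw (S i)) as [w' [a' [<- [_ Haa]]]]. apply Haa. lia.
  - intros x. rewrite H. split; [intros Hx; now exists (fun _ => O)|now intros [_ Hx]].
Qed.

(** Sets which, together with their complements, are results of the Souslin operation form a
    sigma-algebra containing the generators. *)
Lemma suslin_sigma {X} (U : nat -> set X) A :
  sigma_gen (fun B => exists i, forall x, B x <-> U i x) A -> suslin U A.
Proof.
  intros HA. apply (HA (fun A => suslin U A /\ suslin U (fun x => ~ A x))).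
  - split; [|split; [|split]].
    + split.
      * exists (fun _ _ => False). split; [|firstorder].
        intros w a Hw. now destruct (Hw O) as [w' [a' [Hf _]]].
      * exists (fun _ _ => True). split; [easy|]. intros x. split; [|tauto].
        intros _. now exists (fun _ => O).
    + intros A' [H H']. split; [exact H'|].
      apply (suslin_ext U A'); [|exact H]. intros x. split; [tauto|apply NNPP].
    + intros A' H. split; [apply suslin_ex; apply H|].
      apply (suslin_ext U (fun x => forall n, ~ A' n x)); [firstorder|].
      apply (suslin_all U (fun n x => ~ A' n x)). apply H.
    + intros A1 A2 E [H H']. split.
      * now apply (suslin_ext U A1).
      * apply (suslin_ext U (fun x => ~ A1 x)); [|exact H']. intros x. now rewrite E.
  - intros B [i Hi]. split.
    + apply (suslin_bit U _ i true). intros x. unfold bits. now rewrite Hi, decP.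
    + apply (suslin_bit U _ i false). intros x. unfold bits. now rewrite Hi, decF.
Qed.

(** * Coding a standard Borel space by binary sequences *)

Section Coding.

Variables (Y : Type) (dY : Y -> Y -> R) (s : nat -> option Y).
Hypothesis dY_metric : is_metric dY.
Hypothesis dY_complete : complete_metric dY.
Hypothesis s_dense : forall x eps, 0 < eps -> exists n y, s n = Some y /\ dY x y < eps.

Definition ball_i (i : nat) : set Y := fun y =>
  exists c, s (fst (of_nat i)) = Some c /\ dY y c < / INR (S (snd (of_nat i))).

Definition hat : Y -> nat -> bool := bits ball_i.

Lemma dY_sym x y : dY x y = dY y x.
Proof. apply dY_metric. Qed.

Lemma dY_tri x y z : dY x z <= dY x y + dY y z.
Proof. apply dY_metric. Qed.

(** A small enough ball around a centre near [y] contains [y] but not [y']. *)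
Lemma hat_inj y y' : hat y = hat y' -> y = y'.
Proof.
  intros H. destruct dY_metric as (H0 & H1 & _). apply H1. apply NNPP. intros Hne.
  assert (Hp : 0 < dY y y') by (destruct (H0 y y'); [assumption|congruence]).
  destruct (inv_INR_small (dY y y' / 2)) as [k Hk]; [lra|].
  destruct (s_dense y _ (inv_INR_pos k)) as [n [c [Hc Hyc]]].
  assert (Hb : ball_i (to_nat (n, k)) y).
  { exists c. rewrite cancel_of_to. auto. }
  apply decP in Hb. change (hat y (to_nat (n, k)) = true) in Hb. rewrite H in Hb.
  apply (proj1 (decP _)) in Hb. destruct Hb as [c' [Hc' Hyc']]. rewrite cancel_of_to in *.
  cbn [fst snd] in *. rewrite Hc in Hc'. injection Hc' as <-.
  pose proof (dY_tri y c y'). rewrite (dY_sym c) in *. lra.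
Qed.

Lemma ball_i_open i : Defs.open_set dY (ball_i i).
Proof.
  intros y [c [Hc Hy]]. exists (/ INR (S (snd (of_nat i))) - dY y c). split; [lra|].
  intros z Hz. exists c. split; [exact Hc|]. pose proof (dY_tri z y c).
  rewrite (dY_sym z y) in *. lra.
Qed.

Lemma open_union_balls V : Defs.open_set dY V ->
  forall y, V y <-> exists i, (forall z, ball_i i z -> V z) /\ ball_i i y.
Proof.
  intros HV y. split; [|firstorder]. intros Vy. destruct (HV y Vy) as [r [Hr H]].
  destruct (inv_INR_small (r / 2)) as [k Hk]; [lra|].
  destruct (s_dense y _ (inv_INR_pos k)) as [n [c [Hc Hyc]]].
  exists (to_nat (n, k)). unfold ball_i. rewrite cancel_of_to. cbn [fst snd]. split; [|eauto].
  intros z [c' [Hc' Hz]]. rewrite Hc in Hc'. injection Hc' as <-. apply H.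
  pose proof (dY_tri y c z). rewrite (dY_sym c) in *. lra.
Qed.

Lemma borel_balls {X} (S : set X -> Prop) (f : X -> Y) : is_sigma_algebra S ->
  (forall i, S (fun x => ball_i i (f x))) -> forall A, borel dY A -> S (fun x => A (f x)).
Proof.
  intros HS H. apply sa_preimage_gen; [exact HS|]. intros V HV.
  apply (sa_ext HS (fun x => exists i, (forall z, ball_i i z -> V z) /\ ball_i i (f x))).
  - intros x. now rewrite (open_union_balls V HV (f x)).
  - apply (sa_ex HS (fun i x => (forall z, ball_i i z -> V z) /\ ball_i i (f x))).
    intros i. apply sa_and; auto. now apply sa_prop.
Qed.

(** The set of codes of points need not be closed; [w] turns being a code into a closed condition.
    Its slice 0 lists centres converging to [y] at a fixed rate, its slice 1 the margins by which
    [y] lies inside each ball containing it. *)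
Definition good (w : nat -> nat) (y : Y) : Prop :=
  (forall m, exists c, s (slice 0 w m) = Some c /\ dY y c <= / INR (S m)) /\
  (forall i c, s (fst (of_nat i)) = Some c -> ball_i i y ->
     dY y c + / INR (S (slice 1 w i)) <= / INR (S (snd (of_nat i)))).

Lemma good_exists y : exists w, good w y.
Proof.
  assert (H0 : forall m, exists n, exists c, s n = Some c /\ dY y c <= / INR (S m)).
  { intros m. destruct (s_dense y _ (inv_INR_pos m)) as [n [c [Hc Hlt]]].
    exists n, c. split; [exact Hc|lra]. }
  apply choice in H0. destruct H0 as [f Hf].
  assert (H1 : forall i, exists k, forall c, s (fst (of_nat i)) = Some c -> ball_i i y ->
     dY y c + / INR (S k) <= / INR (S (snd (of_nat i)))).
  { intros i. destruct (classic (ball_i i y)) as [[c [Hc Hlt]]|Hno]; [|exists O; easy].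
    destruct (inv_INR_small (/ INR (S (snd (of_nat i))) - dY y c)) as [k Hk]; [lra|].
    exists k. intros c' Hc' _. rewrite Hc in Hc'. injection Hc' as <-. lra. }
  apply choice in H1. destruct H1 as [g Hg].
  exists (join (fun k => match k with O => f | _ => g end)). unfold good.
  rewrite !slice_join. auto.
Qed.

Lemma dist_limit_le (u : nat -> Y) y c r N : converges_to dY u y ->
  (forall n, (N <= n)%nat -> dY (u n) c <= r) -> dY y c <= r.
Proof.
  intros Hu H. apply Rnot_lt_le. intros Hlt.
  destruct (Hu (dY y c - r)) as [M HM]; [lra|].
  specialize (HM (M + N)%nat ltac:(lia)). specialize (H (M + N)%nat ltac:(lia)).
  pose proof (dY_tri y (u (M + N)%nat) c). pose proof (dY_sym y (u (M + N)%nat)). lra.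
Qed.

(** The fixed rate makes the points [ys n] Cauchy. A bit 1 survives in the limit because of the
    margin recorded in slice 1, a bit 0 because the balls are open. *)
Lemma good_limit w a (ws : nat -> nat -> nat) (ys : nat -> Y) :
  (forall n, good (ws n) (ys n) /\ agree n w (ws n) /\ agree n a (hat (ys n))) ->
  exists y, a = hat y /\ good w y.
Proof.
  intros H.
  assert (Hw : forall k m, exists N, forall n, (N <= n)%nat -> slice k (ws n) m = slice k w m).
  { intros k m. destruct (agree_slice k (S m)) as [N HN]. exists N. intros n Hn.
    symmetry. apply HN; [|lia]. eapply agree_le; [exact Hn|]. apply H. }
  assert (Hc : forall m, exists N c, s (slice 0 w m) = Some c /\
      forall n, (N <= n)%nat -> dY (ys n) c <= / INR (S m)).
  { intros m. destruct (Hw O m) as [N HN].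
    destruct (proj1 (H N)) as [Hg _]. destruct (Hg m) as [c [Hc _]].
    rewrite HN in Hc by lia. exists N, c. split; [exact Hc|]. intros n Hn.
    destruct (proj1 (H n)) as [Hg' _]. destruct (Hg' m) as [c' [Hc' Hle]].
    rewrite HN in Hc' by lia. rewrite Hc in Hc'. now injection Hc' as <-. }
  destruct (dY_complete ys) as [y Hy].
  { intros eps Heps. destruct (inv_INR_small (eps / 2)) as [m Hm]; [lra|].
    destruct (Hc m) as [N [c [_ Hd]]]. exists N. intros p q Hp Hq.
    pose proof (dY_tri (ys p) c (ys q)). pose proof (dY_sym c (ys q)).
    pose proof (Hd p Hp). pose proof (Hd q Hq). lra. }
  assert (Hopen : forall i, ball_i i y -> exists N, forall n, (N <= n)%nat -> ball_i i (ys n)).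
  { intros i Hb. destruct (ball_i_open i y Hb) as [r [Hr Hr']].
    destruct (Hy r Hr) as [N HN]. exists N. intros n Hn. apply Hr'.
    rewrite dY_sym. auto. }
  assert (Hgap : forall i c N, s (fst (of_nat i)) = Some c ->
      (forall n, (N <= n)%nat -> ball_i i (ys n)) ->
      dY y c <= / INR (S (snd (of_nat i))) - / INR (S (slice 1 w i))).
  { intros i c N Hs Hb. destruct (Hw 1%nat i) as [M HM].
    apply (dist_limit_le ys y c _ (N + M)); [exact Hy|]. intros n Hn.
    destruct (proj1 (H n)) as [_ Hg]. specialize (Hg i c Hs (Hb n ltac:(lia))).
    rewrite HM in Hg by lia. lra. }
  exists y. split; [|split].
  - apply functional_extensionality. intros i.
    assert (Hai : forall n, (i < n)%nat -> a i = hat (ys n) i).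
    { intros n Hn. destruct (H n) as [_ [_ Ha]]. now apply Ha. }
    symmetry. destruct (a i) eqn:Ea.
    + apply decP.
      assert (Hb : forall n, (S i <= n)%nat -> ball_i i (ys n)).
      { intros n Hn. apply (proj1 (decP _)). symmetry. now apply Hai. }
      destruct (Hb (S i) (le_n _)) as [c [Hs _]]. exists c. split; [exact Hs|].
      pose proof (Hgap i c _ Hs Hb). pose proof (inv_INR_pos (slice 1 w i)). lra.
    + apply decF. intros Hb. destruct (Hopen i Hb) as [N HN].
      specialize (HN (N + S i)%nat ltac:(lia)). apply decP in HN.
      specialize (Hai (N + S i)%nat ltac:(lia)). unfold hat, bits in Hai. congruence.
  - intros m. destruct (Hc m) as [N [c [Hs Hd]]]. exists c. split; [exact Hs|].
    now apply (dist_limit_le ys y c _ N).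
  - intros i c Hs Hb. destruct (Hopen i Hb) as [N HN].
    pose proof (Hgap i c N Hs HN). lra.
Qed.

Definition closed3 (Q : (nat -> nat) -> (nat -> bool) -> (nat -> bool) -> Prop) : Prop :=
  forall w a b, (forall n, exists w' a' b', Q w' a' b' /\ agree n w w' /\ agree n a a' /\ agree n b b')
    -> Q w a b.

(** The bit sequence of a triple for a family generating the product: slices 0 and 1 are the codes
    [a], [b], and all later slices record which equations [z i = n] hold. *)
Definition mix (a b : nat -> bool) (z : nat -> nat) : nat -> bool := join (fun k =>
  match k with
  | O => a
  | 1%nat => b
  | _ => fun j => Nat.eqb (z (fst (of_nat j))) (snd (of_nat j))
  end).

Lemma agree_mix m : exists N, forall a b z a' b' z',
  agree N a a' -> agree N b b' -> agree N z z' -> agree m (mix a b z) (mix a' b' z').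
Proof.
  destruct (bounded_below (fun i => snd (of_nat i)) m) as [N1 H1].
  destruct (bounded_below (fun i => fst (of_nat (snd (of_nat i)))) m) as [N2 H2].
  exists (N1 + N2)%nat. intros a b z a' b' z' Ha Hb Hz i Hi.
  specialize (H1 i Hi). specialize (H2 i Hi). unfold mix, join.
  destruct (fst (of_nat i)) as [|[|k]].
  - apply Ha. lia.
  - apply Hb. lia.
  - rewrite Hz by lia. reflexivity.
Qed.

(** The measurable set of triples is a result of the Souslin operation on a generating family; both
    its witness and the sequence [z] go into [w]. *)
Lemma analytic_code (E : Y -> Y -> Prop) :
  analytic (prod_sigma (borel dY) (borel dY)) (fun p => E (fst p) (snd p)) ->
  exists Q, closed3 Q /\ forall x y, E x y <-> exists w, Q w (hat x) (hat y).
Proof.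
  intros [C [HC HE]].
  set (U := fun i (p : (Y * Y) * (nat -> nat)) =>
    match fst (of_nat i) with
    | O => ball_i (snd (of_nat i)) (fst (fst p))
    | 1%nat => ball_i (snd (of_nat i)) (snd (fst p))
    | _ => snd p (fst (of_nat (snd (of_nat i)))) = snd (of_nat (snd (of_nat i)))
    end).
  assert (HU : forall x y z, bits U ((x, y), z) = mix (hat x) (hat y) z).
  { intros x y z. apply functional_extensionality. intros i. unfold bits, U, mix, join, hat, bits.
    cbn [fst snd]. destruct (fst (of_nat i)) as [|[|k]]; [easy|easy|].
    destruct (Nat.eqb_spec (z (fst (of_nat (snd (of_nat i))))) (snd (of_nat (snd (of_nat i))))).
    - now apply decP.
    - now apply decF. }
  destruct (suslin_sigma U C) as [Q [HQ HCQ]].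
  { pose proof (sigma_gen_sa (fun B => exists i, forall x, B x <-> U i x)) as HS.
    assert (HUi : forall k j, sigma_gen (fun B => exists i, forall x, B x <-> U i x)
        (U (to_nat (k, j)))) by (intros; apply sigma_gen_in; eexists; easy).
    revert HC. apply prod_sigma_min; [exact HS| |].
    - apply (sa_preimage_gen HS). intros A [A1 [A2 [HA1 [HA2 HA]]]].
      apply (sa_ext HS (fun p => A1 (fst (fst p)) /\ A2 (snd (fst p)))); [intros p; now rewrite HA|].
      apply (sa_and HS).
      + revert HA1. apply (borel_balls _ (fun p => fst (fst p))); [exact HS|]. intros j.
        apply (sa_ext HS (U (to_nat (0%nat, j)))); [|apply HUi].
        intros p. unfold U. now rewrite cancel_of_to.
      + revert HA2. apply (borel_balls _ (fun p => snd (fst p))); [exact HS|]. intros j.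
        apply (sa_ext HS (U (to_nat (1%nat, j)))); [|apply HUi].
        intros p. unfold U. now rewrite cancel_of_to.
    - apply (sa_preimage_gen HS). intros A [i [n HA]].
      apply (sa_ext HS (U (to_nat (2%nat, to_nat (i, n))))); [|apply HUi].
      intros p. unfold U. rewrite !cancel_of_to. cbn [fst snd]. rewrite cancel_of_to.
      now rewrite HA. }
  exists (fun w a b => Q (slice 0 w) (mix a b (slice 1 w))). split.
  - intros w a b Hw. apply HQ. intros n.
    destruct (agree_slice 0 n) as [N1 H1]. destruct (agree_mix n) as [N2 H2].
    destruct (agree_slice 1 N2) as [N3 H3].
    destruct (Hw (N1 + N2 + N3)%nat) as [w' [a' [b' [Hq [Hww [Haa Hbb]]]]]].
    exists (slice 0 w'), (mix a' b' (slice 1 w')). split; [exact Hq|]. split.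
    + apply H1. eapply agree_le; [|exact Hww]. lia.
    + apply H2.
      * eapply agree_le; [|exact Haa]. lia.
      * eapply agree_le; [|exact Hbb]. lia.
      * apply H3. eapply agree_le; [|exact Hww]. lia.
  - intros x y. rewrite (HE (x, y)). split.
    + intros [z Hz]. apply HCQ in Hz. destruct Hz as [w Hw]. rewrite HU in Hw.
      exists (join (fun k => match k with O => w | _ => z end)). now rewrite !slice_join.
    + intros [w Hw]. exists (slice 1 w). apply HCQ. exists (slice 0 w). now rewrite HU.
Qed.

(** Each entry of an edge packs one bit of the source, one bit of the target and one entry of the
    witness, so all three projections respect levels. *)
Definition wsrc (e : nat -> nat) : nat -> bool := fun n => Nat.eqb (fst (of_nat (e n))) 1.
Definition wtgt (e : nat -> nat) : nat -> bool :=
  fun n => Nat.eqb (fst (of_nat (snd (of_nat (e n))))) 1.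
Definition wit (e : nat -> nat) : nat -> nat := fun n => snd (of_nat (snd (of_nat (e n)))).

Lemma edge_exists a b w : exists e, wsrc e = a /\ wtgt e = b /\ wit e = w.
Proof.
  exists (fun n => to_nat (if a n then 1 else 0, to_nat (if b n then 1 else 0, w n)))%nat.
  unfold wsrc, wtgt, wit.
  repeat split; apply functional_extensionality; intros n;
    rewrite !cancel_of_to; cbn [fst snd]; rewrite ?cancel_of_to; cbn [fst snd]; auto.
  - now destruct (a n).
  - now destruct (b n).
Qed.

(* Besides a witness of [E], an edge carries witnesses that its ends are codes of points. *)
Lemma edges_exist (E : Y -> Y -> Prop) :
  analytic (prod_sigma (borel dY) (borel dY)) (fun p => E (fst p) (snd p)) ->
  exists EE : (nat -> nat) -> Prop,
    (forall e, (forall n, exists e', EE e' /\ agree n e e') -> EE e) /\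
    (forall x y, E x y -> exists e, EE e /\ wsrc e = hat x /\ wtgt e = hat y) /\
    (forall e, EE e -> exists x y, wsrc e = hat x /\ wtgt e = hat y /\ E x y).
Proof.
  intros HE. destruct (analytic_code E HE) as [Q [HQ HEQ]].
  exists (fun e => exists x y, wsrc e = hat x /\ wtgt e = hat y /\
    good (slice 0 (wit e)) x /\ good (slice 1 (wit e)) y /\
    Q (slice 2 (wit e)) (wsrc e) (wtgt e)).
  split; [|split].
  - intros e He.
    assert (Hl : forall n e', agree n e e' ->
        agree n (wsrc e) (wsrc e') /\ agree n (wtgt e) (wtgt e') /\ agree n (wit e) (wit e')).
    { intros n e' H. unfold wsrc, wtgt, wit. repeat split; intros i Hi; now rewrite (H i Hi). }
    (* Each slice of the witness is approximated separately, since the level required depends on the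
       slice. *)
    assert (Hs : forall k n, exists e', (exists x y, wsrc e' = hat x /\ wtgt e' = hat y /\
        good (slice 0 (wit e')) x /\ good (slice 1 (wit e')) y /\
        Q (slice 2 (wit e')) (wsrc e') (wtgt e')) /\
        agree n (wsrc e) (wsrc e') /\ agree n (wtgt e) (wtgt e') /\
        agree n (slice k (wit e)) (slice k (wit e'))).
    { intros k n. destruct (agree_slice k n) as [N HN].
      destruct (He (N + n)%nat) as [e' [He' Ha]]. exists e'. split; [exact He'|].
      apply Hl in Ha. destruct Ha as [H1 [H2 H3]].
      split; [|split]; [| |apply HN]; (eapply agree_le; [|eassumption]); lia. }
    destruct (choice _ (Hs 0%nat)) as [e0 He0]. destruct (choice _ (Hs 1%nat)) as [e1 He1].
    assert (Hx : forall n, exists x, wsrc (e0 n) = hat x /\ good (slice 0 (wit (e0 n))) x).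
    { intros n. destruct (He0 n) as [[x [y Hxy]] _]. exists x. tauto. }
    assert (Hy : forall n, exists y, wtgt (e1 n) = hat y /\ good (slice 1 (wit (e1 n))) y).
    { intros n. destruct (He1 n) as [[x [y Hxy]] _]. exists y. tauto. }
    apply choice in Hx, Hy. destruct Hx as [xs Hxs], Hy as [ys Hys].
    destruct (good_limit (slice 0 (wit e)) (wsrc e) (fun n => slice 0 (wit (e0 n))) xs) as [x [Ex Gx]].
    { intros n. destruct (He0 n) as [_ [H1 [_ H3]]], (Hxs n) as [Hx1 Hx2].
      rewrite <- Hx1. auto. }
    destruct (good_limit (slice 1 (wit e)) (wtgt e) (fun n => slice 1 (wit (e1 n))) ys) as [y [Ey Gy]].
    { intros n. destruct (He1 n) as [_ [_ [H2 H3]]], (Hys n) as [Hy1 Hy2].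
      rewrite <- Hy1. auto. }
    exists x, y. repeat (split; [assumption|]). apply HQ. intros n.
    destruct (Hs 2%nat n) as [e' [[x' [y' Hxy]] Ha]].
    exists (slice 2 (wit e')), (wsrc e'), (wtgt e'). tauto.
  - intros x y Hxy. apply HEQ in Hxy. destruct Hxy as [w Hw].
    destruct (good_exists x) as [wx Gx]. destruct (good_exists y) as [wy Gy].
    destruct (edge_exists (hat x) (hat y)
      (join (fun k => match k with O => wx | 1%nat => wy | _ => w end))) as [e [E1 [E2 E3]]].
    exists e. split; [|auto]. exists x, y. rewrite E1, E2, E3, !slice_join. auto.
  - intros e [x [y [E1 [E2 [_ [_ Hw]]]]]]. exists x, y. repeat (split; [assumption|]).
    apply HEQ. rewrite E1, E2 in Hw. eauto.
Qed.

End Coding.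

(** * Embedding into the Urysohn space *)

Section Embedding.

Context {U : Type} {d : U -> U -> R} (HU : urysohn d).

Lemma U_sep x y : d x y = 0 <-> x = y.
Proof. apply HU. Qed.

Lemma U_sym x y : d x y = d y x.
Proof. apply HU. Qed.

Lemma U_tri x y z : d x z <= d x y + d y z.
Proof. apply HU. Qed.

Lemma U_inhabited : inhabited U.
Proof. destruct (proj2 HU []) as [u _]; [easy|]. now constructor. Qed.

Variables (Q : Type) (V : Q -> Prop) (D : Q -> Q -> R) (s : nat -> Q).
Hypothesis D_refl : forall q, D q q = 0.
Hypothesis D_sym : forall q q', D q q' = D q' q.
Hypothesis D_tri : forall p q r, V p -> V q -> V r -> D p r <= D p q + D q r.
Hypothesis s_V : forall n, V (s n).
Hypothesis s_dense : forall q eps, V q -> 0 < eps -> exists n, D q (s n) < eps.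

Definition partial_isometry (l : list (Q * U)) : Prop :=
  (forall p, In p l -> V (fst p)) /\
  forall p p', In p l -> In p' l -> d (snd p) (snd p') = D (fst p) (fst p').

(** The triangle inequality for [D] supplies the compatibility that the extension property requires
    of prescribed distances. *)
Lemma partial_isometry_extend l q : partial_isometry l -> V q ->
  exists u, partial_isometry ((q, u) :: l).
Proof.
  intros [HV Hl] Vq.
  destruct (proj2 HU (map (fun p => (snd p, D q (fst p))) l)) as [u Hu].
  - intros p p' Hp Hp'. apply in_map_iff in Hp, Hp'.
    destruct Hp as [r [<- Hr]], Hp' as [r' [<- Hr']]. cbn [fst snd].
    rewrite Hl by assumption. pose proof (HV r Hr). pose proof (HV r' Hr').
    pose proof (D_tri q (fst r) (fst r')). pose proof (D_tri q (fst r') (fst r)).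
    pose proof (D_tri (fst r) q (fst r')).
    pose proof (D_sym (fst r) q). pose proof (D_sym (fst r) (fst r')).
    split; [apply Rabs_le; split|]; intuition lra.
  - exists u. split.
    + intros p [<-|Hp]; auto.
    + assert (Hq : forall p, In p l -> d u (snd p) = D q (fst p)).
      { intros p Hp. apply (Hu (snd p, D q (fst p))). apply in_map_iff. eauto. }
      intros p p' [<-|Hp] [<-|Hp']; cbn [fst snd]; auto.
      * rewrite D_refl. now apply U_sep.
      * rewrite U_sym, D_sym. auto.
Qed.

Lemma isometry_on_sequence : exists us : nat -> U, forall n m, d (us n) (us m) = D (s n) (s m).
Proof.
  set (next := fun n l => epsilon U_inhabited (fun u => partial_isometry ((s n, u) :: l))).
  set (F := fix F n : list (Q * U) :=
    match n with O => [] | S m => (s m, next m (F m)) :: F m end).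
  assert (HF : forall n, partial_isometry (F n)).
  { induction n as [|n IH]; [split; easy|].
    exact (epsilon_spec U_inhabited _ (partial_isometry_extend (F n) (s n) IH (s_V n))). }
  assert (Hin : forall n m, (n < m)%nat -> In (s n, next n (F n)) (F m)).
  { intros n m H. induction H as [|m H IH]; simpl; auto. }
  exists (fun n => next n (F n)). intros n m.
  apply (proj2 (HF (S (n + m))) (s n, _) (s m, _)); apply Hin; lia.
Qed.

(** The isometry on the dense sequence extends by completeness of [U]; outside [V] the value is
    arbitrary. *)
Lemma isometric_embedding :
  exists iota : Q -> U, forall q q', V q -> V q' -> d (iota q) (iota q') = D q q'.
Proof.
  destruct isometry_on_sequence as [us Hus].
  assert (H : forall q, exists x, V q ->
      forall eps, 0 < eps -> exists n, D q (s n) < eps /\ d x (us n) < eps).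
  { intros q. destruct (classic (V q)) as [Vq|Hno].
    2:{ destruct U_inhabited as [x]. now exists x. }
    assert (Hn : forall k, exists n, D q (s n) < / INR (S k)).
    { intros k. apply s_dense; [exact Vq|apply inv_INR_pos]. }
    apply choice in Hn. destruct Hn as [f Hf].
    destruct (proj1 (proj2 (proj1 HU)) (fun k => us (f k))) as [x Hx].
    - intros eps Heps. destruct (inv_INR_small (eps / 2)) as [N HN]; [lra|].
      exists N. intros m n Hm Hn. rewrite Hus.
      pose proof (D_tri (s (f m)) q (s (f n)) (s_V _) Vq (s_V _)) as Ht.
      rewrite (D_sym (s (f m)) q) in Ht.
      pose proof (Hf m). pose proof (Hf n).
      pose proof (inv_INR_le N m Hm). pose proof (inv_INR_le N n Hn). lra.
    - exists x. intros _ eps Heps. destruct (Hx eps Heps) as [N HN].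
      destruct (inv_INR_small eps Heps) as [M HM].
      exists (f (N + M)%nat). split.
      + pose proof (Hf (N + M)%nat). pose proof (inv_INR_le M (N + M) ltac:(lia)). lra.
      + rewrite U_sym. apply HN. lia. }
  apply choice in H. destruct H as [iota Hi]. exists iota. intros q q' Vq Vq'.
  apply cond_eq. intros eps Heps.
  destruct (Hi q Vq (eps / 4)) as [n [Hn1 Hn2]]; [lra|].
  destruct (Hi q' Vq' (eps / 4)) as [m [Hm1 Hm2]]; [lra|].
  pose proof (Hus n m) as E.
  pose proof (U_tri (iota q) (us n) (iota q')). pose proof (U_tri (us n) (us m) (iota q')).
  pose proof (U_tri (us n) (iota q) (us m)). pose proof (U_tri (iota q) (iota q') (us m)).
  pose proof (U_sym (us n) (iota q)). pose proof (U_sym (us m) (iota q')).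
  pose proof (D_tri q (s n) q' Vq (s_V n) Vq'). pose proof (D_tri (s n) (s m) q' (s_V n) (s_V m) Vq').
  pose proof (D_tri (s n) q (s m) (s_V n) Vq (s_V m)). pose proof (D_tri q q' (s m) Vq Vq' (s_V m)).
  pose proof (D_sym (s n) q). pose proof (D_sym (s m) q').
  apply Rabs_def1; lra.
Qed.

End Embedding.

(** * Transfer to closed subsets of the Urysohn space *)

Section Images.

Context {U : Type} {d : U -> U -> R} (HU : urysohn d).
Variables (EE : (nat -> nat) -> Prop) (iota : point -> U).
Notation len := (elen EE).
Hypothesis iota_isometric : forall q q', valid q -> valid q' -> d (iota q) (iota q') = cdist len q q'.

(** The selected part of the comb is complete, hence its isometric image is closed. *)
Lemma image_closed Pr : Defs.closed_set d (fun u => exists q, sub Pr q /\ iota q = u).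
Proof.
  intros u Hu. apply NNPP. intros Hno.
  assert (H : forall k, exists q, sub Pr q /\ d u (iota q) < / INR (S k)).
  { intros k. apply NNPP. intros Hk. apply Hno. exists (/ INR (S k)).
    split; [apply inv_INR_pos|]. intros y Hy [q [Hq <-]]. eauto. }
  apply choice in H. destruct H as [qs Hqs].
  destruct (sub_complete len Pr qs) as [q [Hq Hc]]; [apply Hqs| |].
  - intros eps Heps. destruct (inv_INR_small (eps / 2)) as [N HN]; [lra|].
    exists N. intros m n Hm Hn. destruct (Hqs m) as [Sm Dm], (Hqs n) as [Sn Dn].
    rewrite <- iota_isometric by (apply Sm || apply Sn).
    pose proof (U_tri HU (iota (qs m)) u (iota (qs n))).
    pose proof (U_sym HU (iota (qs m)) u).
    pose proof (inv_INR_le N m Hm). pose proof (inv_INR_le N n Hn). lra.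
  - apply Hu. exists q. split; [exact Hq|]. apply (U_sep HU).
    apply cond_eq. intros eps Heps. rewrite Rminus_0_r.
    destruct (Hc (eps / 2)) as [N HN]; [lra|].
    destruct (inv_INR_small (eps / 2)) as [M HM]; [lra|].
    specialize (HN (N + M)%nat ltac:(lia)). destruct (Hqs (N + M)%nat) as [Sn Dn].
    rewrite <- iota_isometric in HN by (apply Sn || apply Hq).
    pose proof (U_tri HU (iota q) (iota (qs (N + M)%nat)) u).
    pose proof (U_sym HU (iota q) (iota (qs (N + M)%nat))).
    pose proof (U_sym HU u (iota (qs (N + M)%nat))).
    pose proof (inv_INR_le M (N + M) ltac:(lia)).
    rewrite Rabs_pos_eq by apply HU. lra.
Qed.

Definition image (Pr : nat -> nat -> gfun -> Prop) : Msp d := exist _ _ (image_closed Pr).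

Lemma pull Pr (p : pts (image Pr)) : {q | sub Pr q /\ iota q = proj1_sig p}.
Proof. apply constructive_indefinite_description. exact (proj2_sig p). Qed.

Definition push Pr q (Hq : sub Pr q) : pts (image Pr) :=
  exist _ (iota q) (ex_intro _ q (conj Hq eq_refl)).

Lemma push_val Pr q (Hq : sub Pr q) : proj1_sig (push Pr q Hq) = iota q.
Proof. reflexivity. Qed.

Lemma pts_eq {F : Msp d} (p p' : pts F) : proj1_sig p = proj1_sig p' -> p = p'.
Proof. intros H. apply eq_sig_hprop; [|exact H]. intros x. apply proof_irrelevance. Qed.

Lemma pull_push Pr q (Hq : sub Pr q) : proj1_sig (pull Pr (push Pr q Hq)) = q.
Proof.
  destruct (pull Pr (push Pr q Hq)) as [q' [Hq' E]]. simpl in *.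
  apply (D_eq0 len); [apply Hq'|apply Hq|].
  rewrite <- iota_isometric by (apply Hq' || apply Hq). now apply (U_sep HU).
Qed.

Lemma mdist_push Pr q q' (Hq : sub Pr q) (Hq' : sub Pr q') :
  mdist (image Pr) (push Pr q Hq) (push Pr q' Hq') = cdist len q q'.
Proof. apply iota_isometric; [apply Hq|apply Hq']. Qed.

Lemma mdist_pull Pr p p' :
  mdist (image Pr) p p' = cdist len (proj1_sig (pull Pr p)) (proj1_sig (pull Pr p')).
Proof.
  destruct (pull Pr p) as [q [Hq E]], (pull Pr p') as [q' [Hq' E']]. simpl.
  unfold mdist. rewrite <- E, <- E'. apply iota_isometric; [apply Hq|apply Hq'].
Qed.

Lemma image_lipschitz Pr Pr' h k K : 1 <= K ->
  (forall q, sub Pr q -> sub Pr' (h q) /\ k (h q) = q) ->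
  (forall q, sub Pr' q -> sub Pr (k q) /\ h (k q) = q) ->
  (forall q q', sub Pr q -> sub Pr q' -> cdist len (h q) (h q') <= K * cdist len q q') ->
  (forall q q', sub Pr' q -> sub Pr' q' -> cdist len (k q) (k q') <= K * cdist len q q') ->
  lipschitz_isomorphic (mdist (image Pr)) (mdist (image Pr')).
Proof.
  intros HK Hh Hk Lh Lk.
  set (S1 := fun p => proj1 (proj2_sig (pull Pr p))).
  set (S2 := fun p => proj1 (proj2_sig (pull Pr' p))).
  exists (fun p => push Pr' _ (proj1 (Hh _ (S1 p)))), (fun p => push Pr _ (proj1 (Hk _ (S2 p)))), K.
  split; [split|split; [exact HK|]].
  - intros p. apply pts_eq. rewrite push_val, pull_push.
    rewrite (proj2 (Hh _ (S1 p))). apply (proj2_sig (pull Pr p)).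
  - intros p. apply pts_eq. rewrite push_val, pull_push.
    rewrite (proj2 (Hk _ (S2 p))). apply (proj2_sig (pull Pr' p)).
  - intros p p'. rewrite mdist_push, mdist_pull. split; [|apply Lh; apply S1].
    pose proof (Lk _ _ (proj1 (Hh _ (S1 p))) (proj1 (Hh _ (S1 p')))) as L.
    rewrite (proj2 (Hh _ (S1 p))), (proj2 (Hh _ (S1 p'))) in L.
    apply (Rmult_le_reg_l K); [lra|]. rewrite <- Rmult_assoc, Rinv_r by lra. lra.
Qed.

Lemma image_homeo Pr Pr' : homeomorphic (mdist (image Pr)) (mdist (image Pr')) ->
  exists h k, rel_homeo EE (sub Pr) (sub Pr') h k.
Proof.
  intros [f [g [[Hgf Hfg] [Cf Cg]]]].
  (* Maps between subtypes become total functions on [point], the identity outside the subset. *)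
  assert (key : forall Pr Pr' (f : pts (image Pr) -> pts (image Pr')) ,
    exists h : point -> point, forall q (Hq : sub Pr q), h q = proj1_sig (pull Pr' (f (push Pr q Hq)))).
  { clear. intros Pr Pr' f.
    exists (fun q => match excluded_middle_informative (sub Pr q) with
                     | left Hq => proj1_sig (pull Pr' (f (push Pr q Hq)))
                     | right _ => q
                     end).
    intros q Hq. decide_em as [H|H]; [|easy]. now rewrite (proof_irrelevance _ H Hq). }
  assert (cont : forall Pr Pr' (f : pts (image Pr) -> pts (image Pr')) h,
    (forall q (Hq : sub Pr q), h q = proj1_sig (pull Pr' (f (push Pr q Hq)))) ->
    continuous_map (mdist (image Pr)) (mdist (image Pr')) f -> rel_continuous EE (sub Pr) h).
  { clear - iota_isometric HU. intros Pr Pr' f h Hh Cf q eps Hq Heps.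
    destruct (Cf (push Pr q Hq) eps Heps) as [del [Hd H]]. exists del. split; [exact Hd|].
    intros q' Hq' Hlt. rewrite (Hh q Hq), (Hh q' Hq'), <- mdist_pull. apply H.
    now rewrite mdist_push. }
  destruct (key _ _ f) as [h Hh]. destruct (key _ _ g) as [k Hk].
  exists h, k. split; [|split; [|split; eapply cont; eauto]].
  - intros q Hq. assert (Hs : sub Pr' (h q)) by (rewrite (Hh q Hq); exact (proj1 (proj2_sig (pull Pr' _)))).
    split; [exact Hs|]. rewrite (Hk _ Hs).
    replace (push Pr' (h q) Hs) with (f (push Pr q Hq)); [now rewrite Hgf, pull_push|].
    apply pts_eq. rewrite push_val, (Hh q Hq). symmetry. apply (proj2_sig (pull Pr' _)).
  - intros q Hq. assert (Hs : sub Pr (k q)) by (rewrite (Hk q Hq); exact (proj1 (proj2_sig (pull Pr _)))).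
    split; [exact Hs|]. rewrite (Hh _ Hs).
    replace (push Pr (k q) Hs) with (g (push Pr' q Hq)); [now rewrite Hfg, pull_push|].
    apply pts_eq. rewrite push_val, (Hk q Hq). symmetry. apply (proj2_sig (pull Pr _)).
Qed.

(** Whether the image for [y] meets [W] is a countable disjunction: the base part does not depend on
    [y], and each of countably many hairs that meet [W] contributes the condition that it is
    present. *)
Lemma image_measurable {Y} (SY : set Y -> Prop) (Pr : Y -> nat -> nat -> gfun -> Prop) :
  is_sigma_algebra SY ->
  (forall n c g, SY (fun y => Pr y n c g)) ->
  measurable_map SY (effros d) (fun y => image (Pr y)).
Proof.
  intros HS HPr. intros B HB. revert B HB. apply sa_preimage_gen; [exact HS|].
  intros A [W [_ HA]].
  set (idx := fun x : nat * nat * list (list nat) =>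
    SH (fst (fst x)) (snd (fst x)) (cut (fst (fst x)) (G (map pad (snd x))))).
  apply (sa_ext HS (fun y =>
    (exists q g, valid q /\ sd q = SB g /\ W (iota q)) \/
    (exists x : nat * nat * list (list nat), (exists q, valid q /\ sd q = idx x /\ W (iota q)) /\
       Pr y (fst (fst x)) (snd (fst x)) (cut (fst (fst x)) (G (map pad (snd x))))))).
  - intros y. rewrite (HA (image (Pr y))). simpl. split.
    + intros [[q [g [Vq [E Hw]]]]|[x [[q [Vq [E Hw]]] Hp]]]; exists (iota q); (split; [|exact Hw]);
        exists q; (split; [|reflexivity]); split; auto; rewrite E; auto.
    + intros [u [[q [[Vq Hp] <-]] Hw]]. destruct (sd q) as [g|n c g] eqn:E; [left; eauto|].
      right. pose proof Vq as Vq'. unfold valid in Vq'. rewrite E in Vq'.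
      destruct Vq' as [[l ->] _]. destruct (G_words l n) as [w Hw'].
      assert (Ec : cut n (G (map pad w)) = cut n (G l)) by now apply cut_ext.
      exists (n, c, w). unfold idx. cbn [fst snd]. rewrite Ec. split; [eauto|exact Hp].
  - apply sa_or; [exact HS|now apply sa_prop|].
    apply (sa_exists_enum HS (fun (x : nat * nat * list (list nat)) y =>
      (exists q, valid q /\ sd q = idx x /\ W (iota q)) /\
       Pr y (fst (fst x)) (snd (fst x)) (cut (fst (fst x)) (G (map pad (snd x)))))).
    + pose proof enumerated_nat. repeat apply enumerated_prod; auto.
      now repeat apply enumerated_list.
    + intros x. apply sa_and; auto. now apply sa_prop.
Qed.

End Images.

(** Every [f y] is the part of one embedded comb selected by the code of [y]. Related points are
    joined by an edge, along which one translates; for unrelated ones the invariant is the set of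
    codes of points related to [x]. *)
Lemma main_construction (U : Type) (d : U -> U -> R) (HU : urysohn d)
  (Y : Type) (SY : set Y -> Prop) (E : Y -> Y -> Prop) :
  standard_borel SY -> Equivalence E ->
  analytic (prod_sigma SY SY) (fun p => E (fst p) (snd p)) ->
  exists f : Y -> Msp d, measurable_map SY (effros d) f /\
    forall x y,
      (E x y -> lipschitz_isomorphic (mdist (f x)) (mdist (f y))) /\
      (~ E x y -> ~ homeomorphic (mdist (f x)) (mdist (f y))).
Proof.
  intros [dY [[HM [HC [s Hs]]] HSY]] HE HA.
  assert (ES : SY = borel dY).
  { apply functional_extensionality. intros A. apply propositional_extensionality. apply HSY. }
  subst SY. clear HSY.
  destruct (edges_exist Y dY s HM HC Hs E HA) as [EE [Hcl [Hex Hpt]]].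
  set (code := hat Y dY s). fold code in Hex, Hpt.
  assert (Hsrc : forall n e e', agree n e e' -> agree n (wsrc e) (wsrc e')).
  { intros n e e' H i Hi. unfold wsrc. now rewrite (H i Hi). }
  assert (Htgt : forall n e e', agree n e e' -> agree n (wtgt e) (wtgt e')).
  { intros n e e' H i Hi. unfold wtgt. now rewrite (H i Hi). }
  set (Pr := fun y => present EE wsrc wtgt (code y)).
  destruct (valid_separable (elen EE)) as [sq [Hsq Hdense]].
  destruct (isometric_embedding HU point valid (cdist (elen EE)) sq) as [iota Hiota]; auto.
  { apply D_refl. } { apply D_sym. } { apply D_triangle. }
  exists (fun y => image HU EE iota Hiota (Pr y)). split.
  - pose proof (sigma_gen_sa (Defs.open_set dY)) as HS.
    apply image_measurable; [exact HS|]. intros n c g.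
    (* Presence of a hair of level [n] depends on [n] bits of the code, and each bit is an open
       condition on [y]. *)
    refine (sa_bits HS code _ n (fun a => present EE wsrc wtgt a n c g) _).
    + intros i. apply sigma_gen_in. intros y Hy.
      destruct (ball_i_open Y dY s HM i y) as [r [Hr H]].
      { apply (proj1 (decP _)). exact Hy. }
      exists r. split; [exact Hr|]. intros z Hz. apply decP. auto.
    + intros u v Huv. now apply present_agree.
  - intros x y. split.
    + intros Hxy. destruct (Hex x y Hxy) as [e [He [E1 E2]]].
      assert (H1 : forall q, sub (Pr x) q -> sub (Pr y) (tr e q)).
      { intros q. apply (tr_X EE wsrc wtgt e (code x) (code y)); auto. }
      assert (H2 : forall q, sub (Pr y) q -> sub (Pr x) (tr e q)).
      { intros q. apply (tr_X EE wsrc wtgt e (code y) (code x)); auto. }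
      apply (image_lipschitz HU EE iota Hiota _ _ (tr e) (tr e) 3); [lra| | | |].
      * intros q Hq. split; [auto|]. apply tr_tr. apply Hq.
      * intros q Hq. split; [auto|]. apply tr_tr. apply Hq.
      * intros q q'. apply (tr_lipschitz EE wsrc wtgt e (code x)); auto.
      * intros q q'. apply (tr_lipschitz EE wsrc wtgt e (code y)); auto.
    + intros Hno Hh. apply Hno. apply image_homeo in Hh. destruct Hh as [h [k Hh]].
      assert (HP : (exists z, code x = code z /\ E x z) <-> (exists z, code y = code z /\ E x z)).
      { apply (homeo_invariant EE wsrc wtgt Hcl Hsrc Htgt (code x) (code y) h k
          (fun a => exists z, a = code z /\ E x z) Hh).
        (* An edge joins codes of related points, so by transitivity and symmetry both its ends
           belong to the invariant set or neither does. *)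
        intros e He. destruct (Hpt e He) as [y1 [y2 [-> [-> H12]]]].
        split; intros [z [Hz Exz]]; apply (hat_inj Y dY s HM Hs) in Hz; subst z.
        - exists y2. split; [easy|]. now transitivity y1.
        - exists y1. split; [easy|]. transitivity y2; [easy|]. now symmetry. }
      destruct (proj1 HP) as [z [Hz Exz]]; [exists x; split; [easy|reflexivity]|].
      apply (hat_inj Y dY s HM Hs) in Hz. now subst z.
Qed.

(** * Uniform homeomorphism is analytic *)

Section UniformHomeomorphism.

Context {U : Type} {d : U -> U -> R} (HU : urysohn d).
Variable s : nat -> U.
Hypothesis s_dense : forall x eps, 0 < eps -> exists n, d x (s n) < eps.

Notation r := (fun n : nat => (/2) ^ n).

Lemma closed_limit (F : Msp d) (u : nat -> U) l :
  (forall n, proj1_sig F (u n)) -> converges_to d u l -> proj1_sig F l.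
Proof.
  intros Hu Hl. apply NNPP. intros Hno. destruct (proj2_sig F l Hno) as [e [He H]].
  destruct (Hl e He) as [N HN]. apply (H (u N)); [|apply Hu].
  rewrite (U_sym HU). auto.
Qed.

Definition dense_in (F : Msp d) (A : nat -> U) : Prop :=
  (forall k, proj1_sig F (A k)) /\
  forall x eps, proj1_sig F x -> 0 < eps -> exists k, d x (A k) < eps.

Definition seq_unif (A B : nat -> U) : Prop :=
  forall eps, 0 < eps -> exists del, 0 < del /\
    forall k l, d (A k) (A l) < del -> d (B k) (B l) < eps.

(** The closure of the set of pairs [(A k, B k)], which will be the graph of the extended map. *)
Definition corr (A B : nat -> U) (x y : U) : Prop :=
  forall eps, 0 < eps -> exists k, d x (A k) < eps /\ d y (B k) < eps.

Lemma corr_exists F1 F2 A B x : dense_in F1 A -> dense_in F2 B -> seq_unif A B ->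
  proj1_sig F1 x -> exists y, proj1_sig F2 y /\ corr A B x y.
Proof.
  intros [_ HA] [HB _] Hu Fx.
  assert (Hk : forall n, exists k, d x (A k) < / INR (S n)).
  { intros n. apply HA; [exact Fx|apply inv_INR_pos]. }
  apply choice in Hk. destruct Hk as [f Hf].
  destruct (proj1 (proj2 (proj1 HU)) (fun n => B (f n))) as [y Hy].
  - intros eps Heps. destruct (Hu eps Heps) as [del [Hd H]].
    destruct (inv_INR_small (del / 2)) as [N HN]; [lra|].
    exists N. intros m n Hm Hn. apply H.
    pose proof (U_tri HU (A (f m)) x (A (f n))). pose proof (U_sym HU (A (f m)) x).
    pose proof (Hf m). pose proof (Hf n).
    pose proof (inv_INR_le N m Hm). pose proof (inv_INR_le N n Hn). lra.
  - exists y. split; [apply (closed_limit F2 (fun n => B (f n))); auto|].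
    intros eps Heps. destruct (Hy eps Heps) as [N HN].
    destruct (inv_INR_small eps Heps) as [M HM]. exists (f (N + M)%nat). split.
    + pose proof (Hf (N + M)%nat). pose proof (inv_INR_le M (N + M) ltac:(lia)). lra.
    + rewrite (U_sym HU). apply HN. lia.
Qed.

Lemma corr_unif A B : seq_unif A B -> forall eps, 0 < eps -> exists del, 0 < del /\
  forall x x' y y', corr A B x y -> corr A B x' y' -> d x x' < del -> d y y' < eps.
Proof.
  intros Hu eps Heps. destruct (Hu (eps / 2)) as [del [Hd H]]; [lra|].
  exists (del / 2). split; [lra|]. intros x x' y y' Hxy Hxy' Hlt.
  assert (Hm : 0 < Rmin (del / 4) (eps / 4)) by (apply Rmin_glb_lt; lra).
  pose proof (Rmin_l (del / 4) (eps / 4)). pose proof (Rmin_r (del / 4) (eps / 4)).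
  destruct (Hxy _ Hm) as [k [Hk Hk']]. destruct (Hxy' _ Hm) as [l [Hl Hl']].
  assert (HB : d (B k) (B l) < eps / 2).
  { apply H. pose proof (U_tri HU (A k) x (A l)). pose proof (U_tri HU x x' (A l)).
    pose proof (U_sym HU (A k) x). lra. }
  pose proof (U_tri HU y (B k) y'). pose proof (U_tri HU (B k) (B l) y').
  pose proof (U_sym HU (B l) y'). lra.
Qed.

Lemma corr_functional A B x y y' : seq_unif A B -> corr A B x y -> corr A B x y' -> y = y'.
Proof.
  intros Hu Hxy Hxy'. apply (U_sep HU). apply cond_eq. intros eps Heps. rewrite Rminus_0_r.
  rewrite Rabs_pos_eq by apply HU. destruct (corr_unif A B Hu eps Heps) as [del [Hd H]].
  apply (H x x); auto. rewrite (proj2 (U_sep HU x x)); auto.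
Qed.

Lemma corr_sym A B x y : corr A B x y -> corr B A y x.
Proof. intros H eps Heps. destruct (H eps Heps) as [k [H1 H2]]. eauto. Qed.

(** Uniformly continuous maps between dense sequences extend to the complete spaces; the two
    extensions are mutually inverse, as their graphs are converse to each other. *)
Lemma unif_homeo_of_dense F1 F2 A B : dense_in F1 A -> dense_in F2 B ->
  seq_unif A B -> seq_unif B A -> unif_homeomorphic (mdist F1) (mdist F2).
Proof.
  assert (key : forall F1 F2 A B, dense_in F1 A -> dense_in F2 B -> seq_unif A B ->
    exists f : pts F1 -> pts F2, (forall p, corr A B (proj1_sig p) (proj1_sig (f p))) /\
      unif_continuous_map (mdist F1) (mdist F2) f).
  { clear F1 F2 A B. intros F1 F2 A B HA HB Hu.
    assert (Hf : forall p : pts F1, exists q : pts F2, corr A B (proj1_sig p) (proj1_sig q)).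
    { intros [x Fx]. destruct (corr_exists F1 F2 A B x HA HB Hu Fx) as [y [Fy Hy]].
      now exists (exist _ y Fy). }
    apply choice in Hf. destruct Hf as [f Hf]. exists f. split; [exact Hf|].
    intros eps Heps. destruct (corr_unif A B Hu eps Heps) as [del [Hd H]].
    exists del. split; [exact Hd|]. intros p q Hpq. unfold mdist in *. eapply H; eauto. }
  intros HA HB Hu Hu'.
  destruct (key F1 F2 A B HA HB Hu) as [f [Hf Uf]].
  destruct (key F2 F1 B A HB HA Hu') as [g [Hg Ug]].
  exists f, g. split; [split|split; assumption].
  - intros p. apply pts_eq. eapply corr_functional; [exact Hu'|apply Hg|]. apply corr_sym, Hf.
  - intros p. apply pts_eq. eapply corr_functional; [exact Hu|apply Hf|]. apply corr_sym, Hg.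
Qed.

Definition hit (F : Msp d) (i m : nat) : Prop := exists x, proj1_sig F x /\ d (s i) x < r m.

(* [s (a k m)], [m = 0, 1, ...], converge to the [k]-th term of a dense sequence of [F]. *)
Definition approximates (F : Msp d) (a : nat -> nat -> nat) : Prop :=
  (forall k m, d (s (a k m)) (s (a k (S m))) <= r m) /\
  (forall k m, hit F (a k m) m) /\
  (forall j m, hit F j m -> exists k, d (s j) (s (a k m)) <= 4 * r m).

(** The factor 8 leaves room for errors: approximations at level [m] are within [2 * r m] of their
    limits, so limits closer than [r m] have approximations closer than [5 * r m]. *)
Definition modulus (a b : nat -> nat -> nat) (q : nat -> nat) : Prop :=
  forall p k l, d (s (a k (q p))) (s (a l (q p))) < 8 * r (q p) ->
    d (s (b k p)) (s (b l p)) <= r p.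

Lemma approximates_limit F a : approximates F a ->
  exists A, dense_in F A /\ forall k m, d (A k) (s (a k m)) <= 2 * r m.
Proof.
  intros [H1 [H2 H3]].
  (* Telescoping, since [r m = 2 * r m - 2 * r (S m)]. *)
  assert (Hd : forall k m n, d (s (a k m)) (s (a k (m + n)%nat)) <= 2 * r m - 2 * r (m + n)%nat).
  { intros k m n. induction n as [|n IH].
    - rewrite Nat.add_0_r, (proj2 (U_sep HU _ _)) by reflexivity. lra.
    - pose proof (U_tri HU (s (a k m)) (s (a k (m + n)%nat)) (s (a k (m + S n)%nat))).
      specialize (H1 k (m + n)%nat). rewrite Nat.add_succ_r in *. simpl pow in *. lra. }
  assert (HL : forall k, exists x, converges_to d (fun m => s (a k m)) x).
  { intros k. apply (proj1 (proj2 (proj1 HU))). intros eps Heps.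
    destruct (half_pow_small (eps / 4)) as [N HN]; [lra|]. exists N.
    assert (HN' : forall n, (N <= n)%nat -> d (s (a k N)) (s (a k n)) < eps / 2).
    { intros n Hn. specialize (Hd k N (n - N)%nat). replace (N + (n - N))%nat with n in Hd by lia.
      pose proof (half_pow_pos n). lra. }
    intros m n Hm Hn. pose proof (U_tri HU (s (a k m)) (s (a k N)) (s (a k n))).
    pose proof (U_sym HU (s (a k m)) (s (a k N))). pose proof (HN' m Hm). pose proof (HN' n Hn). lra. }
  apply choice in HL. destruct HL as [A HA].
  assert (HAd : forall k m, d (A k) (s (a k m)) <= 2 * r m).
  { intros k m. apply Rnot_lt_le. intros Hlt.
    destruct (HA k (d (A k) (s (a k m)) - 2 * r m)) as [N HN]; [lra|].
    specialize (HN (m + N)%nat ltac:(lia)). cbv beta in HN. specialize (Hd k m N).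
    pose proof (U_tri HU (A k) (s (a k (m + N)%nat)) (s (a k m))).
    pose proof (U_sym HU (A k) (s (a k (m + N)%nat))).
    pose proof (U_sym HU (s (a k m)) (s (a k (m + N)%nat))).
    pose proof (half_pow_pos (m + N)). lra. }
  exists A. split; [split|exact HAd].
  (* Points of [F] within [r n] of [s (a k n)] also converge to [A k], and [F] is closed. *)
  - intros k. destruct (choice _ (H2 k)) as [x Hx].
    apply (closed_limit F x); [apply Hx|]. intros eps Heps.
    destruct (half_pow_small (eps / 3)) as [N HN]; [lra|]. exists N. intros n Hn.
    pose proof (U_tri HU (x n) (s (a k n)) (A k)). pose proof (HAd k n).
    pose proof (proj2 (Hx n)). pose proof (U_sym HU (x n) (s (a k n))).
    pose proof (U_sym HU (A k) (s (a k n))). pose proof (half_pow_le N n Hn). lra.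
  (* The 7 is [1 + 4 + 2]: from [x] to [s j], on to [s (a k m)], and on to [A k]. *)
  - intros x eps Fx Heps. destruct (half_pow_small (eps / 7)) as [m Hm]; [lra|].
    destruct (s_dense x (r m) (half_pow_pos m)) as [j Hj].
    destruct (H3 j m) as [k Hk]; [exists x; now rewrite (U_sym HU)|].
    exists k. pose proof (U_tri HU x (s j) (A k)). pose proof (U_tri HU (s j) (s (a k m)) (A k)).
    pose proof (HAd k m). pose proof (U_sym HU (A k) (s (a k m))). lra.
Qed.

Lemma modulus_unif a b q A B : modulus a b q ->
  (forall k m, d (A k) (s (a k m)) <= 2 * r m) -> (forall k m, d (B k) (s (b k m)) <= 2 * r m) ->
  seq_unif A B.
Proof.
  intros Hq HA HB eps Heps. destruct (half_pow_small (eps / 6)) as [p Hp]; [lra|].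
  pose proof (half_pow_pos (q p)) as Hr. exists (r (q p)). split; [exact Hr|]. intros k l Hlt.
  assert (Hb : d (s (b k p)) (s (b l p)) <= r p).
  { apply Hq. pose proof (HA k (q p)). pose proof (HA l (q p)).
    pose proof (U_tri HU (s (a k (q p))) (A k) (s (a l (q p)))).
    pose proof (U_tri HU (A k) (A l) (s (a l (q p)))).
    pose proof (U_sym HU (A k) (s (a k (q p)))). lra. }
  pose proof (HB k p). pose proof (HB l p).
  pose proof (U_tri HU (B k) (s (b k p)) (B l)).
  pose proof (U_tri HU (s (b k p)) (s (b l p)) (B l)).
  pose proof (U_sym HU (B l) (s (b l p))). lra.
Qed.

Lemma approximates_exists F A : dense_in F A ->
  exists a, approximates F a /\ forall k m, d (A k) (s (a k m)) < r m / 4.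
Proof.
  intros [HF HA].
  assert (Ha : forall k, exists f : nat -> nat, forall m, d (A k) (s (f m)) < r m / 4).
  { intros k. apply (choice (fun m i => d (A k) (s i) < r m / 4)). intros m. apply s_dense.
    pose proof (half_pow_pos m). lra. }
  apply choice in Ha. destruct Ha as [a Ha]. exists a. split; [split; [|split]|exact Ha].
  - intros k m. pose proof (Ha k m). pose proof (Ha k (S m)).
    pose proof (U_tri HU (s (a k m)) (A k) (s (a k (S m)))).
    pose proof (U_sym HU (s (a k m)) (A k)). pose proof (half_pow_pos m). simpl pow in *. lra.
  - intros k m. exists (A k). split; [apply HF|]. rewrite (U_sym HU).
    pose proof (Ha k m). pose proof (half_pow_pos m). lra.
  - intros j m [x [Fx Hx]]. destruct (HA x (r m) Fx (half_pow_pos m)) as [k Hk].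
    exists k. pose proof (U_tri HU (s j) x (s (a k m))). pose proof (U_tri HU x (A k) (s (a k m))).
    pose proof (Ha k m). pose proof (half_pow_pos m). lra.
Qed.

Lemma modulus_exists a b A B : seq_unif A B ->
  (forall k m, d (A k) (s (a k m)) < r m / 4) -> (forall k m, d (B k) (s (b k m)) < r m / 4) ->
  exists q, modulus a b q.
Proof.
  intros Hu HA HB.
  apply (choice (fun p q => forall k l, d (s (a k q)) (s (a l q)) < 8 * r q ->
    d (s (b k p)) (s (b l p)) <= r p)).
  intros p. pose proof (half_pow_pos p). destruct (Hu (r p / 2)) as [del [Hd H']]; [lra|].
  (* Approximations closer than [8 * r q] have limits closer than [8.5 * r q], which is below
     [del]. *)
  destruct (half_pow_small (del / 9)) as [q Hq]; [lra|]. exists q. intros k l Hlt.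
  pose proof (half_pow_pos q).
  assert (Hb : d (B k) (B l) < r p / 2).
  { apply H'. pose proof (HA k q). pose proof (HA l q).
    pose proof (U_tri HU (A k) (s (a k q)) (A l)). pose proof (U_tri HU (s (a k q)) (s (a l q)) (A l)).
    pose proof (U_sym HU (s (a l q)) (A l)). lra. }
  pose proof (HB k p). pose proof (HB l p).
  pose proof (U_tri HU (s (b k p)) (B k) (s (b l p))). pose proof (U_tri HU (B k) (B l) (s (b l p))).
  pose proof (U_sym HU (s (b k p)) (B k)). lra.
Qed.

(** For every ball about some [s i] that meets [F], a point of [F] in it is chosen; [p0] serves the
    other balls. *)
Lemma dense_sequence (F : Msp d) (p0 : pts F) :
  exists A : nat -> pts F, dense_in F (fun k => proj1_sig (A k)).
Proof.
  assert (H : forall n, exists p : pts F, hit F (fst (of_nat n)) (snd (of_nat n)) ->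
    d (s (fst (of_nat n))) (proj1_sig p) < r (snd (of_nat n))).
  { intros n. destruct (classic (hit F (fst (of_nat n)) (snd (of_nat n)))) as [[x [Fx Hx]]|Hno].
    - now exists (exist _ x Fx).
    - now exists p0. }
  apply choice in H. destruct H as [A HA]. exists A. split; [intros k; apply proj2_sig|].
  intros x eps Fx Heps. destruct (half_pow_small (eps / 2)) as [m Hm]; [lra|].
  destruct (s_dense x (r m) (half_pow_pos m)) as [i Hi]. exists (to_nat (i, m)).
  specialize (HA (to_nat (i, m))). rewrite cancel_of_to in HA. cbn [fst snd] in HA.
  assert (Hh : hit F i m) by (exists x; now rewrite (U_sym HU)).
  specialize (HA Hh). pose proof (U_tri HU x (s i) (proj1_sig (A (to_nat (i, m))))). lra.
Qed.

(** An empty space has no dense sequence, so the pair of empty spaces is listed separately.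
    Otherwise the image of a dense sequence under the homeomorphism is dense in the other space. *)
Lemma unif_homeo_iff (F1 F2 : Msp d) :
  unif_homeomorphic (mdist F1) (mdist F2) <->
  (~ (exists x, proj1_sig F1 x) /\ ~ (exists x, proj1_sig F2 x)) \/
  exists a b q q', approximates F1 a /\ approximates F2 b /\ modulus a b q /\ modulus b a q'.
Proof.
  split.
  - intros [f [g [[Hgf Hfg] [Uf Ug]]]].
    destruct (classic (exists x, proj1_sig F1 x)) as [[x Fx]|Hno].
    2:{ left. split; [exact Hno|]. intros [y Fy]. apply Hno.
        exists (proj1_sig (g (exist _ y Fy))). apply proj2_sig. }
    right. destruct (dense_sequence F1 (exist _ x Fx)) as [A HA].
    set (B := fun k => proj1_sig (f (A k))).
    assert (HB : dense_in F2 B).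
    { split; [intros k; apply proj2_sig|]. intros y eps Fy Heps.
      destruct (Uf eps Heps) as [del [Hd H]].
      destruct (proj2 HA (proj1_sig (g (exist _ y Fy))) del (proj2_sig _) Hd) as [k Hk].
      exists k. specialize (H _ _ Hk). now rewrite Hfg in H. }
    assert (HAB : seq_unif (fun k => proj1_sig (A k)) B).
    { intros eps Heps. destruct (Uf eps Heps) as [del [Hd H]]. exists del. split; [exact Hd|].
      intros k l. apply (H (A k) (A l)). }
    assert (HBA : seq_unif B (fun k => proj1_sig (A k))).
    { intros eps Heps. destruct (Ug eps Heps) as [del [Hd H]]. exists del. split; [exact Hd|].
      intros k l Hlt. specialize (H (f (A k)) (f (A l)) Hlt). now rewrite !Hgf in H. }
    destruct (approximates_exists F1 _ HA) as [a [Ha Ha']].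
    destruct (approximates_exists F2 _ HB) as [b [Hb Hb']].
    destruct (modulus_exists a b _ _ HAB Ha' Hb') as [q Hq].
    destruct (modulus_exists b a _ _ HBA Hb' Ha') as [q' Hq'].
    exists a, b, q, q'. auto.
  - intros [[H1 H2]|[a [b [q [q' [Ha [Hb [Hq Hq']]]]]]]].
    + exists (fun p => False_rect _ (H1 (ex_intro _ _ (proj2_sig p)))),
        (fun p => False_rect _ (H2 (ex_intro _ _ (proj2_sig p)))).
      split; [split|split].
      * intros p. destruct (H1 (ex_intro _ _ (proj2_sig p))).
      * intros p. destruct (H2 (ex_intro _ _ (proj2_sig p))).
      * intros eps Heps. exists 1. split; [lra|]. intros p. destruct (H1 (ex_intro _ _ (proj2_sig p))).
      * intros eps Heps. exists 1. split; [lra|]. intros p. destruct (H2 (ex_intro _ _ (proj2_sig p))).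
    + destruct (approximates_limit F1 a Ha) as [A [HA HA']].
      destruct (approximates_limit F2 b Hb) as [B [HB HB']].
      apply (unif_homeo_of_dense F1 F2 A B); auto.
      * now apply (modulus_unif a b q).
      * now apply (modulus_unif b a q').
Qed.

(** * Measurability of the witness conditions *)

Notation SS := (prod_sigma (prod_sigma (effros d) (effros d)) baire_sigma).

Lemma SS_sa : is_sigma_algebra SS.
Proof. apply sigma_gen_sa. Qed.

Lemma SS_coord i n : SS (fun x => snd x i = n).
Proof.
  apply (prod_sigma_snd _ _ (fun z : nat -> nat => z i = n)); [apply sigma_gen_sa|].
  apply sigma_gen_in. exists i, n. easy.
Qed.

(** A coordinate of the witness takes countably many values, so it may be treated as a constant. *)
Lemma SS_subst i (P : nat -> set ((Msp d * Msp d) * (nat -> nat))) :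
  (forall n, SS (P n)) -> SS (fun x => P (snd x i) x).
Proof.
  intros H. apply (sa_ext SS_sa (fun x => exists n, snd x i = n /\ P n x)).
  - intros x. split; [intros [n [<- Hn]]; exact Hn|eauto].
  - apply (sa_ex SS_sa (fun n x => snd x i = n /\ P n x)). intros n.
    apply (sa_and SS_sa); auto using SS_coord.
Qed.

Lemma SS_coord2 i j (P : nat -> nat -> Prop) : SS (fun x => P (snd x i) (snd x j)).
Proof.
  apply (SS_subst i (fun n x => P n (snd x j))). intros n.
  apply (SS_subst j (fun m _ => P n m)). intros m. apply (sa_prop SS_sa).
Qed.

Lemma SS_open1 V : Defs.open_set d V -> SS (fun x => exists u, proj1_sig (fst (fst x)) u /\ V u).
Proof.
  intros HV. apply (prod_sigma_fst _ _ (fun p : Msp d * Msp d => exists u, proj1_sig (fst p) u /\ V u));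
    [apply sigma_gen_sa|].
  apply (prod_sigma_fst _ _ (fun F : Msp d => exists u, proj1_sig F u /\ V u)); [apply sigma_gen_sa|].
  apply sigma_gen_in. exists V. easy.
Qed.

Lemma SS_open2 V : Defs.open_set d V -> SS (fun x => exists u, proj1_sig (snd (fst x)) u /\ V u).
Proof.
  intros HV. apply (prod_sigma_fst _ _ (fun p : Msp d * Msp d => exists u, proj1_sig (snd p) u /\ V u));
    [apply sigma_gen_sa|].
  apply (prod_sigma_snd _ _ (fun F : Msp d => exists u, proj1_sig F u /\ V u)); [apply sigma_gen_sa|].
  apply sigma_gen_in. exists V. easy.
Qed.

Lemma ball_open x c : Defs.open_set d (fun y => d x y < c).
Proof.
  intros y Hy. exists (c - d x y). split; [lra|]. intros z Hz.
  pose proof (U_tri HU x y z). lra.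
Qed.

Lemma SS_nonempty (pr : Msp d * Msp d -> Msp d) :
  (forall V, Defs.open_set d V -> SS (fun x => exists u, proj1_sig (pr (fst x)) u /\ V u)) ->
  SS (fun x => exists u, proj1_sig (pr (fst x)) u).
Proof.
  intros H. apply (sa_ext SS_sa (fun x => exists u, proj1_sig (pr (fst x)) u /\ True)).
  - intros x. split; [intros [u [Hu _]]; eauto|intros [u Hu]; eauto].
  - apply (H (fun _ => True)). intros y _. exists 1. split; [lra|easy].
Qed.

Definition table (k : nat) (z : nat -> nat) : nat -> nat -> nat := fun i => slice i (slice k z).

Lemma SS_approximates (pr : Msp d * Msp d -> Msp d) k :
  (forall V, Defs.open_set d V -> SS (fun x => exists u, proj1_sig (pr (fst x)) u /\ V u)) ->
  SS (fun x => approximates (pr (fst x)) (table k (snd x))).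
Proof.
  intros H.
  assert (Hhit : forall i m, SS (fun x => hit (pr (fst x)) i m)).
  { intros i m. apply (H (fun u => d (s i) u < r m)). apply ball_open. }
  unfold approximates, table, slice. apply (sa_and SS_sa); [|apply (sa_and SS_sa)].
  - apply (sa_all SS_sa). intros i. apply (sa_all SS_sa). intros m.
    apply (SS_coord2 _ _ (fun u v => d (s u) (s v) <= r m)).
  - apply (sa_all SS_sa). intros i. apply (sa_all SS_sa). intros m.
    apply (SS_subst _ (fun n x => hit (pr (fst x)) n m)). auto.
  - apply (sa_all SS_sa). intros j. apply (sa_all SS_sa). intros m.
    apply (sa_imp SS_sa); [apply Hhit|]. apply (sa_ex SS_sa). intros i.
    apply (SS_subst _ (fun n _ => d (s j) (s n) <= 4 * r m)). intros n. apply (sa_prop SS_sa).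
Qed.

Lemma SS_modulus k l q : SS (fun x => modulus (table k (snd x)) (table l (snd x)) (slice q (snd x))).
Proof.
  unfold modulus, table, slice.
  apply (sa_all SS_sa). intros p. apply (sa_all SS_sa). intros i. apply (sa_all SS_sa). intros j.
  apply (sa_imp SS_sa).
  - apply (SS_subst (to_nat (q, p)) (fun n x =>
      d (s (snd x (to_nat (k, to_nat (i, n))))) (s (snd x (to_nat (k, to_nat (j, n))))) < 8 * r n)).
    intros n. apply (SS_coord2 _ _ (fun u v => d (s u) (s v) < 8 * r n)).
  - apply (SS_coord2 _ _ (fun u v => d (s u) (s v) <= r p)).
Qed.

(** One sequence carries both tables of approximations and both moduli as its slices 0 to 3. *)
Lemma unif_homeo_analytic : analytic (prod_sigma (effros d) (effros d))
  (fun p => unif_homeomorphic (mdist (fst p)) (mdist (snd p))).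
Proof.
  exists (fun x =>
    (~ (exists u, proj1_sig (fst (fst x)) u) /\ ~ (exists u, proj1_sig (snd (fst x)) u)) \/
    (approximates (fst (fst x)) (table 0 (snd x)) /\ approximates (snd (fst x)) (table 1 (snd x)) /\
     modulus (table 0 (snd x)) (table 1 (snd x)) (slice 2 (snd x)) /\
     modulus (table 1 (snd x)) (table 0 (snd x)) (slice 3 (snd x)))).
  split.
  - apply (sa_or SS_sa); apply (sa_and SS_sa);
      [| | |apply (sa_and SS_sa); [|apply (sa_and SS_sa)]].
    + apply (sa_not SS_sa), SS_nonempty, SS_open1.
    + apply (sa_not SS_sa), SS_nonempty, SS_open2.
    + apply (SS_approximates fst), SS_open1.
    + apply (SS_approximates snd), SS_open2.
    + apply SS_modulus.
    + apply SS_modulus.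
  - intros [F1 F2]. cbn [fst snd]. rewrite unif_homeo_iff. split.
    + intros [H|[a [b [q [q' H]]]]]; [exists (fun _ => O); now left|].
      exists (join (fun k => match k with
        | O => join a | 1%nat => join b | 2%nat => q | _ => q' end)).
      right.
      assert (Ht : forall (w : nat -> nat -> nat) k c, w k = join c -> table k (join w) = c).
      { intros w k c E. apply functional_extensionality. intros i. unfold table.
        now rewrite slice_join, E, slice_join. }
      rewrite !slice_join. rewrite (Ht _ 0%nat a eq_refl), (Ht _ 1%nat b eq_refl). exact H.
    + intros [z [H|H]]; [now left|right]. eauto.
Qed.

End UniformHomeomorphism.

Theorem mainTheorem12 :
  forall (U : Type) (d : U -> U -> R), urysohn d ->
  (* main construction *)
  (forall (Y : Type) (SY : set Y -> Prop) (E : Y -> Y -> Prop),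
     standard_borel SY -> Equivalence E ->
     analytic (prod_sigma SY SY) (fun p => E (fst p) (snd p)) ->
     exists f : Y -> Msp d, measurable_map SY (effros d) f /\
       forall x y,
         (E x y -> lipschitz_isomorphic (mdist (f x)) (mdist (f y))) /\
         (~ E x y -> ~ homeomorphic (mdist (f x)) (mdist (f y)))) /\
  (* uniform homeomorphism on M is a complete analytic equivalence relation *)
  (analytic (prod_sigma (effros d) (effros d))
     (fun p => unif_homeomorphic (mdist (fst p)) (mdist (snd p))) /\
   forall (Y : Type) (SY : set Y -> Prop) (E : Y -> Y -> Prop),
     standard_borel SY -> Equivalence E ->
     analytic (prod_sigma SY SY) (fun p => E (fst p) (snd p)) ->
     exists g : Y -> Msp d, measurable_map SY (effros d) g /\
       forall x y, E x y <-> unif_homeomorphic (mdist (g x)) (mdist (g y))).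
Proof.
  intros U d HU.
  assert (Hmain := main_construction U d HU). split; [exact Hmain|split].
  (* The given dense sequence may be undefined at some indices; [u0] fills the gaps. *)
  - destruct (proj2 (proj2 (proj1 HU))) as [so Hso]. destruct (U_inhabited HU) as [u0].
    apply (unif_homeo_analytic HU (fun n => match so n with Some y => y | None => u0 end)).
    intros x eps Heps. destruct (Hso x eps Heps) as [n [y [E Hy]]]. exists n. now rewrite E.
  - intros Y SY E HY HE HA. destruct (Hmain Y SY E HY HE HA) as [f [Hf H]].
    exists f. split; [exact Hf|]. intros x y. split.
    + intros Hxy. destruct (proj1 (H x y) Hxy) as [f0 [g0 [K [[Hgf Hfg] [HK HL]]]]].
      assert (HK0 : 0 < / K) by (apply Rinv_0_lt_compat; lra).
      (* The modulus [/ K * eps] serves both maps, by the upper Lipschitz bound for [f0] and by the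
         lower one for [g0]. *)
      exists f0, g0. split; [now split|split].
      * intros eps Heps. exists (/ K * eps). split; [now apply Rmult_lt_0_compat|].
        intros a b Hab. eapply Rle_lt_trans; [apply HL|].
        apply (Rmult_lt_reg_l (/ K)); [exact HK0|].
        rewrite <- Rmult_assoc, Rinv_l by lra. lra.
      * intros eps Heps. exists (/ K * eps). split; [now apply Rmult_lt_0_compat|].
        intros a b Hab. destruct (HL (g0 a) (g0 b)) as [HL1 _]. rewrite !Hfg in HL1.
        apply (Rmult_lt_reg_l (/ K)); [exact HK0|]. lra.
    (* A uniform homeomorphism is a homeomorphism, which the construction excludes for unrelated
       points. *)
    + intros [f0 [g0 [Hi [Uf Ug]]]]. apply NNPP. intros Hno. apply (proj2 (H x y) Hno).
      exists f0, g0. split; [exact Hi|split].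
      * intros a eps Heps. destruct (Uf eps Heps) as [del [Hd Hu]]. exists del. auto.
      * intros a eps Heps. destruct (Ug eps Heps) as [del [Hd Hu]]. exists del. auto.
Qed.
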